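(* Let $\mathcal{C}$ be a CwF equipped with a weakly stable weak identity type structure. Then there exist a CwF $\mathcal{D}$ equipped with a (strictly) stable weak identity type structure and a trivial fibration $F:\mathcal{D}\to\mathcal{C}$ of CwFs that weakly preserves identity types: for every object $\Gamma$ of $\mathcal{D}$, type $A\in\mathsf{Ty}_{\mathcal{D}}(\Gamma)$ and term $x\in\mathsf{Tm}_{\mathcal{D}}(\Gamma,A)$, the types $F(\mathsf{Id}^{\mathcal{D}}(A[\mathbf{p}_A],x[\mathbf{p}_A],\mathbf{q}_A))$ and $\mathsf{Id}^{\mathcal{C}}_{(F\Gamma,FA,Fx)}$ over $F(\Gamma.A)=F\Gamma.FA$ are equivalent (with respect to the identity types of $\mathcal{C}$).
   Context: A CwF consists of a category with terminal object $\diamond$, a presheaf $\mathsf{Ty}$ of types, sets $\mathsf{Tm}(\Gamma,A)$ of terms, functorial substitution, and context extensions $\Gamma.A$ with $\mathbf{p}_A:\Gamma.A\to\Gamma$, $\mathbf{q}_A\in\mathsf{Tm}(\Gamma.A,A[\mathbf{p}_A])$ such that maps $\Delta\to\Gamma.A$ correspond bijectively to pairs $(\rho:\Delta\to\Gamma,\ a\in\mathsf{Tm}(\Delta,A[\rho]))$; $\rho^+:\Delta.A[\rho]\to\Gamma.A$ denotes $\langle\rho\circ\mathbf{p},\mathbf{q}\rangle$. CwF morphisms preserve all structure strictly. A CwF morphism $F:\mathcal{D}\to\mathcal{C}$ is a trivial fibration if it is equipped with chosen lifts: for every object $\Gamma$ of $\mathcal{D}$ and $A\in\mathsf{Ty}_{\mathcal{C}}(F\Gamma)$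 a type $A_0\in\mathsf{Ty}_{\mathcal{D}}(\Gamma)$ with $F(A_0)=A$, and for every $A\in\mathsf{Ty}_{\mathcal{D}}(\Gamma)$ and $a\in\mathsf{Tm}_{\mathcal{C}}(F\Gamma,FA)$ a term $a_0\in\mathsf{Tm}_{\mathcal{D}}(\Gamma,A)$ with $F(a_0)=a$. Weakly stable weak identity types on $\mathcal{C}$: for each $(\Gamma,A,x)$ with $x\in\mathsf{Tm}(\Gamma,A)$, a type $\mathsf{Id}_{(\Gamma,A,x)}\in\mathsf{Ty}(\Gamma.A)$ and $\mathsf{refl}_{(\Gamma,A,x)}\in\mathsf{Tm}(\Gamma,\mathsf{Id}_{(\Gamma,A,x)}[\langle\mathrm{id},x\rangle])$; and for each $\gamma:\Delta\to\Gamma$, $P\in\mathsf{Ty}(\Delta.A[\gamma].\mathsf{Id}_{(\Gamma,A,x)}[\gamma^+])$ and $d\in\mathsf{Tm}(\Delta,P')$ with $P'=P[\langle\mathrm{id},x[\gamma],\mathsf{refl}_{(\Gamma,A,x)}[\gamma]\rangle]$, terms $\mathsf{J}\in\mathsf{Tm}(\Delta.A[\gamma].\mathsf{Id}_{(\Gamma,A,x)}[\gamma^+],P)$ and $\mathsf{J}\beta\in\mathsf{Tm}(\Delta,\mathsf{Id}_{(\Delta,P',d)}[\langle\mathrm{id},\mathsf{J}[\langle\mathrm{id},x[\gamma],\mathsf{refl}_{(\Gamma,A,x)}[\gamma]\rangle]\rangle])$; no naturality in the context is required. A (strictly) stable weak identity type structure consists of $\mathsf{Id}(A,x,y)\in\mathsf{Ty}(\Gamma)$,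 $\mathsf{refl}(A,x)\in\mathsf{Tm}(\Gamma,\mathsf{Id}(A,x,x))$, and for $P\in\mathsf{Ty}(\Gamma.A.\mathsf{Id}(A[\mathbf{p}],x[\mathbf{p}],\mathbf{q}))$, $d\in\mathsf{Tm}(\Gamma,P[\langle\mathrm{id},x,\mathsf{refl}(A,x)\rangle])$ terms $\mathsf{J}(A,x,P,d)\in\mathsf{Tm}(\Gamma.A.\mathsf{Id}(A[\mathbf{p}],x[\mathbf{p}],\mathbf{q}),P)$ and $\mathsf{J}\beta(A,x,P,d)$ of type $\mathsf{Id}(P[\langle\mathrm{id},x,\mathsf{refl}\rangle],\mathsf{J}(A,x,P,d)[\langle\mathrm{id},x,\mathsf{refl}\rangle],d)$, all strictly commuting with substitution. Two types over the same context are equivalent if there are maps in both directions between their terms (terms in the extended contexts) that are mutually inverse up to typal equality, in the usual homotopy-type-theoretic sense using the identity types of $\mathcal{C}$. *)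

(* Defs.v *)
(* Vanilla tactics, Stdlib only. *)
From Stdlib Require Import Eqdep.
Export EqNotations.

Set Implicit Arguments.
Unset Strict Implicit.
Unset Printing Implicit Defensive.

(* Equality of elements of a family whose indices are only provably equal;
   it includes the equality of the indices. *)
Definition oeq {I : Type} {T : I -> Type} {i j : I} (a : T i) (b : T j) : Prop :=
  existT T i a = existT T j b.

Notation "a ≡ b" := (oeq a b) (at level 70, no associativity).

(* A single universe for all the sorts of a CwF, so that all CwFs have the same
   size.  The sorts play the role of sets: equality is Leibniz equality,
   used together with uniqueness of identity proofs (Eqdep). *)
Definition Small := Type.

Declare Scope cwf_scope.
Delimit Scope cwf_scope with cwf.

Record CwF := {
  Ob : Small;
  Hom : Ob -> Ob -> Small;
  idh : forall Γ, Hom Γ Γ;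
  comp : forall {Γ Δ Θ}, Hom Δ Γ -> Hom Θ Δ -> Hom Θ Γ;
  comp_id_l : forall Δ Γ (σ : Hom Δ Γ), comp (idh Γ) σ = σ;
  comp_id_r : forall Δ Γ (σ : Hom Δ Γ), comp σ (idh Δ) = σ;
  comp_assoc : forall Γ Δ Θ Ξ (σ : Hom Δ Γ) (τ : Hom Θ Δ) (υ : Hom Ξ Θ),
    comp (comp σ τ) υ = comp σ (comp τ υ);

  emp : Ob;
  bang : forall Γ, Hom Γ emp;
  bang_uniq : forall Γ (σ : Hom Γ emp), σ = bang Γ;

  Ty : Ob -> Small;
  tsub : forall {Δ Γ}, Ty Γ -> Hom Δ Γ -> Ty Δ;
  tsub_id : forall Γ (A : Ty Γ), tsub A (idh Γ) = A;
  tsub_comp : forall Γ Δ Θ (A : Ty Γ) (σ : Hom Δ Γ) (τ : Hom Θ Δ),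
    tsub A (comp σ τ) = tsub (tsub A σ) τ;

  Tm : forall Γ, Ty Γ -> Small;
  sub : forall {Δ Γ} {A : Ty Γ}, Tm A -> forall σ : Hom Δ Γ, Tm (tsub A σ);
  sub_id : forall Γ (A : Ty Γ) (a : Tm A), sub a (idh Γ) ≡ a;
  sub_comp : forall Γ Δ Θ (A : Ty Γ) (a : Tm A) (σ : Hom Δ Γ) (τ : Hom Θ Δ),
    sub a (comp σ τ) ≡ sub (sub a σ) τ;

  ext : forall Γ, Ty Γ -> Ob;
  p : forall {Γ} (A : Ty Γ), Hom (ext A) Γ;
  q : forall {Γ} (A : Ty Γ), Tm (tsub A (p A));
  pair : forall {Δ Γ} {A : Ty Γ} (σ : Hom Δ Γ), Tm (tsub A σ) -> Hom Δ (ext A);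
  p_pair : forall Δ Γ (A : Ty Γ) (σ : Hom Δ Γ) (a : Tm (tsub A σ)),
    comp (p A) (pair a) = σ;
  q_pair : forall Δ Γ (A : Ty Γ) (σ : Hom Δ Γ) (a : Tm (tsub A σ)),
    sub (q A) (pair a) ≡ a;
  pair_uniq : forall Δ Γ (A : Ty Γ) (σ τ : Hom Δ (ext A)),
    comp (p A) σ = comp (p A) τ -> sub (q A) σ ≡ sub (q A) τ -> σ = τ
}.

Arguments Hom {c}.
Arguments idh {c}.
Arguments comp {c Γ Δ Θ}.
Arguments emp {c}.
Arguments bang {c}.
Arguments Ty {c}.
Arguments tsub {c Δ Γ}.
Arguments Tm {c Γ}.
Arguments sub {c Δ Γ A}.
Arguments ext {c Γ}.
Arguments p {c Γ}.
Arguments q {c Γ}.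
Arguments pair {c Δ Γ A}.

Notation "σ ∘ τ" := (comp σ τ) (at level 40, left associativity) : cwf_scope.
Notation "A [[ σ ]]" := (tsub A σ) (at level 8, left associativity,
  format "A [[ σ ]]") : cwf_scope.
Notation "a [< σ >]" := (sub a σ) (at level 8, left associativity,
  format "a [< σ >]") : cwf_scope.
Local Open Scope cwf_scope.

Section Derived.
Context {C : CwF}.
Implicit Types Γ Δ Θ : Ob C.

(* ⟨id, x⟩ *)
Definition inst {Γ} {A : Ty Γ} (x : Tm A) : Hom Γ (ext A) :=
  pair (idh Γ) (rew <- [Tm] (tsub_id A) in x).

(* σ⁺ *)
Definition lift {Δ Γ} (σ : Hom Δ Γ) (A : Ty Γ) : Hom (ext A[[σ]]) (ext A) :=
  pair (σ ∘ p A[[σ]]) (rew <- [Tm] (tsub_comp A σ (p A[[σ]])) in q A[[σ]]).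

Lemma oeq_sym {I : Type} {T : I -> Type} {i j : I} (a : T i) (b : T j) :
  a ≡ b -> b ≡ a.
Proof. exact (@eq_sym _ _ _). Qed.

Lemma oeq_trans {I : Type} {T : I -> Type} {i j k : I}
  (a : T i) (b : T j) (c : T k) : a ≡ b -> b ≡ c -> a ≡ c.
Proof. exact (@eq_trans _ _ _ _). Qed.

Lemma rew_oeq {I : Type} {T : I -> Type} {i j : I} (e : i = j) (a : T i) :
  rew [T] e in a ≡ a.
Proof. destruct e; reflexivity. Qed.

Lemma rew_r_oeq {I : Type} {T : I -> Type} {i j : I} (e : i = j) (a : T j) :
  rew <- [T] e in a ≡ a.
Proof. destruct e; reflexivity. Qed.

Lemma sub_cong {Δ Γ} {A B : Ty Γ} (a : Tm A) (b : Tm B) (σ : Hom Δ Γ) :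
  a ≡ b -> a[<σ>] ≡ b[<σ>].
Proof.
exact (fun e => f_equal
  (fun t : {X : Ty Γ & Tm X} => existT Tm (projT1 t)[[σ]] (projT2 t)[<σ>]) e).
Qed.

Lemma sub_cong_hom {Δ Γ} {A : Ty Γ} (a : Tm A) (σ τ : Hom Δ Γ) :
  σ = τ -> a[<σ>] ≡ a[<τ>].
Proof. intros []; reflexivity. Qed.

Lemma p_inst {Γ} {A : Ty Γ} (x : Tm A) : p A ∘ inst x = idh Γ.
Proof. apply p_pair. Qed.

Lemma q_inst {Γ} {A : Ty Γ} (x : Tm A) : (q A)[<inst x>] ≡ x.
Proof. exact (oeq_trans (q_pair _) (rew_r_oeq _ _)). Qed.

Lemma p_lift {Δ Γ} (σ : Hom Δ Γ) (A : Ty Γ) : p A ∘ lift σ A = σ ∘ p A[[σ]].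
Proof. apply p_pair. Qed.

Lemma q_lift {Δ Γ} (σ : Hom Δ Γ) (A : Ty Γ) : (q A)[<lift σ A>] ≡ q A[[σ]].
Proof. exact (oeq_trans (q_pair _) (rew_r_oeq _ _)). Qed.

Lemma tsub_p_inst {Γ} {A : Ty Γ} (x : Tm A) (B : Ty Γ) :
  B[[p A]][[inst x]] = B.
Proof. now rewrite <- tsub_comp, p_inst, tsub_id. Qed.

Lemma sub_p_inst {Γ} {A B : Ty Γ} (x : Tm A) (b : Tm B) :
  b[<p A>][<inst x>] ≡ b.
Proof.
apply oeq_trans with (1 := oeq_sym (sub_comp b (p A) (inst x))).
apply oeq_trans with (1 := sub_cong_hom b (p_inst x)).
apply sub_id.
Qed.

Lemma inst_sub {Δ Γ} {A : Ty Γ} (x : Tm A) (σ : Hom Δ Γ) :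
  inst x ∘ σ = lift σ A ∘ inst x[<σ>].
Proof.
apply pair_uniq.
- now rewrite <- !comp_assoc, p_inst, p_lift, comp_assoc, p_inst,
    comp_id_l, comp_id_r.
- apply oeq_trans with (1 := sub_comp _ _ _).
  apply oeq_trans with (1 := sub_cong σ (q_inst x)).
  apply oeq_sym.
  apply oeq_trans with (1 := sub_comp _ _ _).
  apply oeq_trans with (1 := sub_cong _ (q_lift σ A)).
  apply q_inst.
Qed.

Lemma tsub_inst_lift {Δ Γ} {A : Ty Γ} (x : Tm A) (σ : Hom Δ Γ) (B : Ty (ext A)) :
  B[[inst x]][[σ]] = B[[lift σ A]][[inst x[<σ>]]].
Proof. now rewrite <- !tsub_comp, inst_sub. Qed.

End Derived.

Record WeakIdIntro (C : CwF) := {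
  wId : forall (Γ : Ob C) (A : Ty Γ) (x : Tm A), Ty (ext A);
  wrefl : forall (Γ : Ob C) (A : Ty Γ) (x : Tm A), Tm (wId x)[[inst x]]
}.

Arguments wId {C} w {Γ A} x.
Arguments wrefl {C} w {Γ A} x.

(* ⟨id, x[γ], refl[γ]⟩ *)
Definition wrefl_inst {C : CwF} (I : WeakIdIntro C) {Δ Γ : Ob C} {A : Ty Γ}
    (x : Tm A) (γ : Hom Δ Γ) : Hom Δ (ext (wId I x)[[lift γ A]]) :=
  pair (inst x[<γ>])
       (rew [Tm] (tsub_inst_lift x γ (wId I x)) in (wrefl I x)[<γ>]).

Record WeaklyStableId (C : CwF) := {
  wintro :> WeakIdIntro C;
  wJ : forall (Δ Γ : Ob C) (A : Ty Γ) (x : Tm A) (γ : Hom Δ Γ)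
    (P : Ty (ext (wId wintro x)[[lift γ A]]))
    (d : Tm P[[wrefl_inst wintro x γ]]), Tm P;
  wJβ : forall (Δ Γ : Ob C) (A : Ty Γ) (x : Tm A) (γ : Hom Δ Γ)
    (P : Ty (ext (wId wintro x)[[lift γ A]]))
    (d : Tm P[[wrefl_inst wintro x γ]]),
    Tm (wId wintro d)[[inst (wJ d)[<wrefl_inst wintro x γ>]]]
}.

Record StableIdIntro (D : CwF) := {
  sId : forall (Γ : Ob D) (A : Ty Γ) (x y : Tm A), Ty Γ;
  sId_sub : forall (Δ Γ : Ob D) (A : Ty Γ) (x y : Tm A) (σ : Hom Δ Γ),
    (sId x y)[[σ]] = sId x[<σ>] y[<σ>];
  srefl : forall (Γ : Ob D) (A : Ty Γ) (x : Tm A), Tm (sId x x);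
  srefl_sub : forall (Δ Γ : Ob D) (A : Ty Γ) (x : Tm A) (σ : Hom Δ Γ),
    (srefl x)[<σ>] ≡ srefl x[<σ>]
}.

Arguments sId {D} s {Γ A} x y.
Arguments sId_sub {D} s {Δ Γ A} x y σ.
Arguments srefl {D} s {Γ A} x.
Arguments srefl_sub {D} s {Δ Γ A} x σ.

Section StableDerived.
Context {D : CwF} (I : StableIdIntro D).
Implicit Types Γ Δ : Ob D.

(* Id(A[p], x[p], q) *)
Definition sIdFam {Γ} {A : Ty Γ} (x : Tm A) : Ty (ext A) :=
  sId I x[<p A>] (q A).

Lemma sId_cong {Γ} {A B : Ty Γ} (x y : Tm A) (x' y' : Tm B) :
  x ≡ x' -> y ≡ y' -> sId I x y = sId I x' y'.
Proof.
intros ex ey.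
pose proof (projT1_eq ex) as e; simpl in e; subst B.
apply inj_pair2 in ex; apply inj_pair2 in ey; now subst.
Qed.

Lemma srefl_cong {Γ} {A B : Ty Γ} (x : Tm A) (x' : Tm B) :
  x ≡ x' -> srefl I x ≡ srefl I x'.
Proof.
intros ex.
pose proof (projT1_eq ex) as e; simpl in e; subst B.
apply inj_pair2 in ex; now subst.
Qed.

Lemma sIdFam_inst {Γ} {A : Ty Γ} (x : Tm A) :
  (sIdFam x)[[inst x]] = sId I x x.
Proof.
unfold sIdFam; rewrite sId_sub.
apply sId_cong; [apply sub_p_inst | apply q_inst].
Qed.

Lemma sub_p_lift {Δ Γ} {A B : Ty Γ} (b : Tm B) (σ : Hom Δ Γ) :
  b[<p A>][<lift σ A>] ≡ b[<σ>][<p A[[σ]]>].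
Proof.
apply oeq_trans with (1 := oeq_sym (sub_comp b (p A) (lift σ A))).
apply oeq_trans with (1 := sub_cong_hom b (p_lift σ A)).
apply sub_comp.
Qed.

Lemma sIdFam_lift {Δ Γ} {A : Ty Γ} (x : Tm A) (σ : Hom Δ Γ) :
  (sIdFam x)[[lift σ A]] = sIdFam x[<σ>].
Proof.
unfold sIdFam; rewrite sId_sub.
apply sId_cong; [apply sub_p_lift | apply q_lift].
Qed.

(* ⟨id, x, refl⟩ *)
Definition srefl_inst {Γ} {A : Ty Γ} (x : Tm A) : Hom Γ (ext (sIdFam x)) :=
  pair (inst x) (rew <- [Tm] (sIdFam_inst x) in srefl I x).

(* σ⁺⁺, with the domain Δ.A[σ].Id(A[p],x[p],q)[σ⁺] of (σ⁺)⁺ rewritten to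
   Δ.A[σ].Id(A[σ][p],x[σ][p],q). *)
Definition sIdFam_lift2 {Δ Γ} (σ : Hom Δ Γ) {A : Ty Γ} (x : Tm A) :
    Hom (ext (sIdFam x[<σ>])) (ext (sIdFam x)) :=
  rew [fun X => Hom (ext X) (ext (sIdFam x))] (sIdFam_lift x σ) in
    lift (lift σ A) (sIdFam x).

Lemma p_rew_lift {Δ Γ} (σ : Hom Δ Γ) (A : Ty Γ) (B : Ty Δ) (e : A[[σ]] = B) :
  p A ∘ (rew [fun X => Hom (ext X) (ext A)] e in lift σ A) = σ ∘ p B.
Proof. destruct e; apply p_lift. Qed.

Lemma q_rew_lift {Δ Γ} (σ : Hom Δ Γ) (A : Ty Γ) (B : Ty Δ) (e : A[[σ]] = B) :
  (q A)[<rew [fun X => Hom (ext X) (ext A)] e in lift σ A>] ≡ q B.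
Proof. destruct e; apply q_lift. Qed.

Lemma srefl_inst_sub {Δ Γ} {A : Ty Γ} (x : Tm A) (σ : Hom Δ Γ) :
  srefl_inst x ∘ σ = sIdFam_lift2 σ x ∘ srefl_inst x[<σ>].
Proof.
unfold sIdFam_lift2, srefl_inst; apply pair_uniq.
- rewrite <- !comp_assoc, p_pair, p_rew_lift, comp_assoc, p_pair.
  apply inst_sub.
- apply oeq_trans with (1 := sub_comp _ _ _).
  apply oeq_trans with (1 := sub_cong σ (q_pair _)).
  apply oeq_trans with (1 := sub_cong σ (rew_r_oeq _ _)).
  apply oeq_trans with (1 := srefl_sub I x σ).
  apply oeq_sym.
  apply oeq_trans with (1 := sub_comp _ _ _).
  apply oeq_trans with (1 := sub_cong _ (q_rew_lift _)).
  apply oeq_trans with (1 := q_pair _).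
  apply rew_r_oeq.
Qed.

Lemma tsub_srefl_inst {Δ Γ} {A : Ty Γ} (x : Tm A) (σ : Hom Δ Γ)
    (P : Ty (ext (sIdFam x))) :
  P[[srefl_inst x]][[σ]] = P[[sIdFam_lift2 σ x]][[srefl_inst x[<σ>]]].
Proof. now rewrite <- !tsub_comp, srefl_inst_sub. Qed.

(* d[σ], retyped as a premise of J over Δ *)
Definition sub_prem {Δ Γ} {A : Ty Γ} {x : Tm A} {P : Ty (ext (sIdFam x))}
    (d : Tm P[[srefl_inst x]]) (σ : Hom Δ Γ) :
    Tm P[[sIdFam_lift2 σ x]][[srefl_inst x[<σ>]]] :=
  rew [Tm] (tsub_srefl_inst σ P) in d[<σ>].

End StableDerived.

Record StableId (D : CwF) := {
  sintro :> StableIdIntro D;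
  sJ : forall (Γ : Ob D) (A : Ty Γ) (x : Tm A) (P : Ty (ext (sIdFam sintro x)))
    (d : Tm P[[srefl_inst sintro x]]), Tm P;
  sJ_sub : forall (Δ Γ : Ob D) (A : Ty Γ) (x : Tm A)
    (P : Ty (ext (sIdFam sintro x))) (d : Tm P[[srefl_inst sintro x]])
    (σ : Hom Δ Γ),
    (sJ d)[<sIdFam_lift2 sintro σ x>] = sJ (sub_prem d σ);
  sJβ : forall (Γ : Ob D) (A : Ty Γ) (x : Tm A) (P : Ty (ext (sIdFam sintro x)))
    (d : Tm P[[srefl_inst sintro x]]),
    Tm (sId sintro (sJ d)[<srefl_inst sintro x>] d);
  sJβ_sub : forall (Δ Γ : Ob D) (A : Ty Γ) (x : Tm A)
    (P : Ty (ext (sIdFam sintro x))) (d : Tm P[[srefl_inst sintro x]])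
    (σ : Hom Δ Γ),
    (sJβ d)[<σ>] ≡ sJβ (sub_prem d σ)
}.

(* Preservation of bang and of pairing follows from the uniqueness clauses. *)
Record CwFMor (D C : CwF) := {
  fob :> Ob D -> Ob C;
  fhom : forall {Δ Γ}, Hom Δ Γ -> Hom (fob Δ) (fob Γ);
  fhom_id : forall Γ, fhom (idh Γ) = idh (fob Γ);
  fhom_comp : forall Γ Δ Θ (σ : Hom Δ Γ) (τ : Hom Θ Δ),
    fhom (σ ∘ τ) = fhom σ ∘ fhom τ;
  fty : forall {Γ}, Ty Γ -> Ty (fob Γ);
  fty_sub : forall Δ Γ (A : Ty Γ) (σ : Hom Δ Γ), fty A[[σ]] = (fty A)[[fhom σ]];
  ftm : forall {Γ} {A : Ty Γ}, Tm A -> Tm (fty A);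
  ftm_sub : forall Δ Γ (A : Ty Γ) (a : Tm A) (σ : Hom Δ Γ),
    ftm a[<σ>] ≡ (ftm a)[<fhom σ>];
  fob_emp : fob emp = emp;
  fob_ext : forall Γ (A : Ty Γ), fob (ext A) = ext (fty A);
  fhom_p : forall Γ (A : Ty Γ),
    rew [fun X => Hom X (fob Γ)] (fob_ext A) in fhom (p A) = p (fty A);
  ftm_q : forall Γ (A : Ty Γ),
    rew [fun X => {B : Ty X & Tm B}] (fob_ext A) in
      existT Tm (fty A[[p A]]) (ftm (q A))
    = existT Tm (fty A)[[p (fty A)]] (q (fty A))
}.

Arguments fhom {D C} c {Δ Γ}.
Arguments fty {D C} c {Γ}.
Arguments ftm {D C} c {Γ A}.
Arguments fob_ext {D C} c {Γ}.

Record TrivialFibration (D C : CwF) (F : CwFMor D C) := {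
  lift_ty : forall (Γ : Ob D) (A : Ty (F Γ)), {A0 : Ty Γ | fty F A0 = A};
  lift_tm : forall (Γ : Ob D) (A : Ty Γ) (a : Tm (fty F A)),
    {a0 : Tm A | ftm F a0 = a}
}.

(* The type of identifications between x and y, obtained from the family
   Id_(Γ,A,x) over Γ.A. *)
Definition wEq {C : CwF} (I : WeakIdIntro C) {Γ : Ob C} {A : Ty Γ}
    (x y : Tm A) : Ty Γ := (wId I x)[[inst y]].

(* For f in context Γ.A of type B and g in context Γ.B of type A, the term
   g[⟨p, f⟩] in context Γ.A, retyped from A[p][⟨p, f⟩] to A[p]. *)
Lemma tsub_p_pair {C : CwF} {Γ : Ob C} {A B : Ty Γ} (f : Tm B[[p A]]) :
  A[[p B]][[pair (p A) f]] = A[[p A]].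
Proof. now rewrite <- tsub_comp, p_pair. Qed.

Definition fun_comp {C : CwF} {Γ : Ob C} {A B : Ty Γ}
    (g : Tm A[[p B]]) (f : Tm B[[p A]]) : Tm A[[p A]] :=
  rew [Tm] (tsub_p_pair f) in g[<pair (p A) f>].

Definition ty_equivalent {C : CwF} (I : WeaklyStableId C) {Γ : Ob C}
    (A B : Ty Γ) : Prop :=
  exists (f : Tm B[[p A]]) (g : Tm A[[p B]]),
    inhabited (Tm (wEq I (fun_comp g f) (q A))) /\
    inhabited (Tm (wEq I (fun_comp f g) (q B))).

(* The two types over FΓ.FA are compared after transporting the first one along
   the equality F(Γ.A) = FΓ.FA. *)
Definition WeaklyPreservesId (D C : CwF) (ID : StableId D)
    (IC : WeaklyStableId C) (F : CwFMor D C) : Prop :=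
  forall (Γ : Ob D) (A : Ty Γ) (x : Tm A),
    ty_equivalent IC
      (rew [Ty] (fob_ext F A) in fty F (sId ID x[<p A>] (q A)))
      (wId IC (ftm F x)).

(* Main.v *)
(* D is the free dependently typed syntax over C: it has a type generator for
   every type of C over the interpretation of a context and a term generator for
   every term of C, and no equations, so F (interpretation) lifts types and terms
   by construction.  Id and refl are made stable by evaluating those of C at the
   generic pair of a type A = S(s) and a term x : A, which lives over the context
   W.S when the generator S lives over W.

   J is made stable in the same way, provided the data (A, x, P, d) have generic
   forms: to each datum one must assign, invariantly under substitution, a datum
   over some context Γ of which it is an instance along a unique substitution.
   Collapsing the maximal subterms of P that avoid the two variables bound by P
   gives a shape invariant under substitution.  The generic form of a shape is
   the anti-unifier of the class of all data of this shape: its variables are the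
   families of subterms, indexed by the class, that do not all have the same head.
   Since distinct expressions over Γ are separated by the class, every type
   equation that holds for all the data of the class holds for the anti-unifier,
   which is therefore well typed. *)

From Stdlib Require Import List Arith Lia Eqdep Classical ProofIrrelevance
  FunctionalExtensionality IndefiniteDescription.
Require Import Defs.
Import ListNotations.

Set Implicit Arguments.
Unset Strict Implicit.
Unset Printing Implicit Defensive.
Local Open Scope cwf_scope.

(** * Identity types in C *)

Section Values.
Context {C : CwF}.
Implicit Types Γ Δ : Ob C.

(** The obstacle is the motive of [J]: nothing beyond identity types is assumed of [C], so there is
    no universe or Π-type through which a variable motive could be classified by a type of [C].
    Freeness supplies the replacement. A type of [D] is never a variable, so its head generator
    survives every substitution, and two motives can be compared node by node. In [C] itself only
    the existence of [J] and [Jβ] over one context at a time is used; the inhabitants found there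
    return to [D] as new term generators. What [C] lacks is any equation between a substituted
    identity type and the identity type of the substituted terms. This gap is crossed in two ways.
    Path types on its two sides are shown to be inhabited together, which is enough to inhabit [Jβ].
    And the identity family of [D] together with its reflexivity is interpreted by a substitution
    instance of one generic identity type, to which the weakly stable eliminator applies; hence it
    has the lifting property [is_id_family], and families with that property over the same point are
    equivalent. *)

Definition val Γ := {A : Ty Γ & Tm A}.

Definition vsub {Δ Γ} (v : val Γ) (σ : Hom Δ Γ) : val Δ :=
  existT _ (projT1 v)[[σ]] (projT2 v)[<σ>].

Lemma vsub_comp Γ Δ Θ (v : val Γ) (σ : Hom Δ Γ) (τ : Hom Θ Δ) :
  vsub v (σ ∘ τ) = vsub (vsub v σ) τ.
Proof. destruct v; apply sub_comp. Qed.

Lemma sub_vsub {Δ Γ} {A : Ty Γ} (a : Tm A) (σ : Hom Δ Γ) :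
  existT (@Tm C Δ) A[[σ]] a[<σ>] = vsub (existT _ A a) σ.
Proof. reflexivity. Qed.

Lemma oeq_ty {Γ} {A B : Ty Γ} {a : Tm A} {b : Tm B} : a ≡ b -> A = B.
Proof. exact (@projT1_eq _ _ _ _). Qed.

(** Pairing with the type equation as a hypothesis, which spares the callers a transport of [b]. *)
Lemma hom_into_ext {Δ Γ} {A : Ty Γ} (σ : Hom Δ Γ) {B : Ty Δ} (b : Tm B) :
  B = A[[σ]] ->
  exists τ : Hom Δ (ext A), p A ∘ τ = σ /\ (q A)[<τ>] ≡ b.
Proof.
intros ->; exists (pair σ b); split; [apply p_pair | apply q_pair].
Qed.

Lemma hom_ext_eq {Δ Γ} {A : Ty Γ} (σ τ : Hom Δ (ext A)) :
  p A ∘ σ = p A ∘ τ ->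
  vsub (existT _ _ (q A)) σ = vsub (existT _ _ (q A)) τ -> σ = τ.
Proof. apply pair_uniq. Qed.

Lemma q_inst_vsub {Γ} {A : Ty Γ} (x : Tm A) :
  vsub (existT _ _ (q A)) (inst x) = existT _ A x.
Proof. exact (q_inst x). Qed.

Lemma q_lift_vsub {Δ Γ} (σ : Hom Δ Γ) (A : Ty Γ) :
  vsub (existT _ _ (q A)) (lift σ A) = existT _ _ (q A[[σ]]).
Proof. exact (q_lift σ A). Qed.

(** Factors an arbitrary map into [ext A] through a lift, the only shape to which the rule [wJ]
    applies. *)
Lemma lift_inst_eq {Δ Γ} {A : Ty Γ} (τ : Hom Δ (ext A)) (b : Tm A[[p A ∘ τ]]) :
  b ≡ (q A)[<τ>] -> lift (p A ∘ τ) A ∘ inst b = τ.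
Proof.
intros e; apply hom_ext_eq.
- now rewrite <- comp_assoc, p_lift, comp_assoc, p_inst, comp_id_r.
- now rewrite vsub_comp, q_lift_vsub, q_inst_vsub, <- sub_vsub.
Qed.

Lemma cast_tm {Γ} {A B : Ty Γ} : A = B -> inhabited (Tm A) -> inhabited (Tm B).
Proof. now intros ->. Qed.

Lemma retype {Γ} {A B : Ty Γ} (a : Tm A) : A = B -> exists b : Tm B, b ≡ a.
Proof. intros <-; now exists a. Qed.

End Values.

(** * Path calculus in [C], and uniqueness of identity families up to equivalence *)

Section Paths.
Context {C : CwF} (IC : WeaklyStableId C).
Implicit Types Γ Δ : Ob C.

Definition path {Γ} {A : Ty Γ} (a b : Tm A) : Prop :=
  inhabited (Tm (wEq IC a b)).

(* A lifting property of a family I over Δ.A pointed over a, shared by all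
   substitution instances of the weakly stable identity types. *)
Definition is_id_family {Δ} {A : Ty Δ} (a : Tm A) (I : Ty (ext A))
    (ρ : Tm I[[inst a]]) : Prop :=
  forall r : Hom Δ (ext I), p I ∘ r = inst a -> (q I)[<r>] ≡ ρ ->
  forall (P : Ty (ext I)) (d : Tm P[[r]]),
  exists j : Tm P, path d j[<r>].

(** The two projections force [τ] to be [lift γ A] and [r] to be [wrefl_inst], so the weakly stable
    eliminator applies verbatim. The equational hypotheses let interpretations of expressions be
    recognized as instances. *)
Lemma instance_is_id_family {Δ Γ} {A : Ty Γ} (x : Tm A) (γ : Hom Δ Γ)
    {B : Ty Δ} (a : Tm B) (τ : Hom (ext B) (ext A)) (I : Ty (ext B))
    (ρ : Tm I[[inst a]]) :
  a ≡ x[<γ>] -> p A ∘ τ = γ ∘ p B -> (q A)[<τ>] ≡ q B ->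
  I = (wId IC x)[[τ]] -> ρ ≡ (wrefl IC x)[<γ>] ->
  is_id_family ρ.
Proof.
intros ea pτ qτ eI eρ r pr qr P d.
pose proof (oeq_ty ea); subst B.
apply inj_pair2 in ea; subst a.
assert (τ = lift γ A) as ->.
{ apply pair_uniq; [now rewrite p_lift|].
  exact (oeq_trans qτ (oeq_sym (q_lift γ A))). }
subst I.
assert (r = wrefl_inst IC x γ) as ->.
{ unfold wrefl_inst; apply pair_uniq.
  - now rewrite p_pair.
  - apply oeq_trans with (1 := qr).
    apply oeq_trans with (1 := eρ).
    apply oeq_sym, (oeq_trans (q_pair _)), rew_oeq. }
exists (wJ d); constructor; apply wJβ.
Qed.

(** [J] along [p A ∘ τ] for the motive [Q] weakened along [p I]. The identification lives in an
    instance of the family of [x], not in the family of [a] itself. *)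
Lemma transport {Δ Γ} {A : Ty Γ} (x : Tm A) (τ : Hom Δ (ext A))
    {B : Ty Δ} (a b : Tm B) (Q : Ty (ext B)) :
  a ≡ x[<p A ∘ τ>] -> b ≡ (q A)[<τ>] ->
  inhabited (Tm (wId IC x)[[τ]]) ->
  inhabited (Tm Q[[inst a]]) -> inhabited (Tm Q[[inst b]]).
Proof.
intros ea eb [e] [d].
pose proof (oeq_ty ea); subst B.
apply inj_pair2 in ea; subst a.
set (I := (wId IC x)[[lift (p A ∘ τ) A]]).
assert (er : Q[[p I]][[wrefl_inst IC x (p A ∘ τ)]] = Q[[inst x[<p A ∘ τ>]]]).
{ rewrite <- tsub_comp; f_equal; apply p_pair. }
pose (j := wJ (rew <- [Tm] er in d)).
(* The point ⟨id, [b], [e]⟩ at which [J] is read off. *)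
destruct (@hom_into_ext C Δ _ I (inst b) _ e) as (s & ps & _).
{ unfold I; rewrite <- tsub_comp; f_equal; symmetry; now apply lift_inst_eq. }
constructor.
refine (rew [Tm] _ in j[<s>]).
now rewrite <- tsub_comp, ps.
Qed.

Lemma path_refl {Γ} {A : Ty Γ} (a : Tm A) : path a a.
Proof. constructor; apply wrefl. Qed.

(** The working substitute for stability of [Id]: both types contain a reflexivity, and each
    direction transports it along the given element of the other type. *)
Lemma path_instance {Δ Γ} {A : Ty Γ} (x : Tm A) (τ : Hom Δ (ext A))
    {B : Ty Δ} (a b : Tm B) :
  a ≡ x[<p A ∘ τ>] -> b ≡ (q A)[<τ>] ->
  inhabited (Tm (wId IC x)[[τ]]) <-> path a b.
Proof.
intros ea eb; split; intros h.
- apply (transport ea eb (Q := wId IC a) h), path_refl.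
- pose proof (oeq_ty ea); subst B.
  apply inj_pair2 in ea; subst a.
  apply (@cast_tm C Δ (wId IC x)[[lift (p A ∘ τ) A]][[inst b]]).
  { rewrite <- tsub_comp; f_equal; now apply lift_inst_eq. }
  apply (@transport Δ Δ _ x[<p A ∘ τ>] (inst b) _ x[<p A ∘ τ>] b); auto.
  + rewrite p_inst; apply oeq_sym, sub_id.
  + apply oeq_sym, q_inst.
  + apply (cast_tm (tsub_inst_lift x (p A ∘ τ) (wId IC x))).
    constructor; exact (wrefl IC x)[<p A ∘ τ>].
Qed.

Lemma path_oeq {Γ} {A B : Ty Γ} (a b : Tm A) (a' b' : Tm B) :
  a ≡ a' -> b ≡ b' -> path a b -> path a' b'.
Proof.
intros ea eb.
pose proof (oeq_ty ea); subst B.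
apply inj_pair2 in ea, eb; now subst.
Qed.

Lemma path_sub {Δ Γ} {A : Ty Γ} (a b : Tm A) (σ : Hom Δ Γ) {B : Ty Δ}
    (a' b' : Tm B) :
  a' ≡ a[<σ>] -> b' ≡ b[<σ>] ->
  inhabited (Tm (wEq IC a b)[[σ]]) <-> path a' b'.
Proof.
intros ea eb; unfold wEq; rewrite <- tsub_comp.
apply path_instance.
- now rewrite <- comp_assoc, p_inst, comp_id_l.
- apply oeq_trans with (1 := eb), oeq_sym.
  unfold oeq; now rewrite sub_vsub, vsub_comp, q_inst_vsub.
Qed.

(** Transport in the family of paths into [a]. Its fibres are substituted path types, which
    [path_sub] trades for genuine ones. *)
Lemma path_sym {Γ} {A : Ty Γ} (a b : Tm A) : path a b -> path b a.
Proof.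
intros h.
apply (@path_sub _ _ _ (q A) a[<p A>] (inst b)).
- apply oeq_sym, q_inst.
- apply oeq_sym, sub_p_inst.
- apply (@transport Γ Γ A a (inst b) A a b); auto.
  + rewrite p_inst; apply oeq_sym, sub_id.
  + apply oeq_sym, q_inst.
  + apply path_sub with (3 := path_refl a).
    * apply oeq_sym, q_inst.
    * apply oeq_sym, sub_p_inst.
Qed.

Lemma path_trans {Γ} {A : Ty Γ} (a b c : Tm A) :
  path a b -> path b c -> path a c.
Proof.
intros h k.
apply (@transport Γ Γ A b (inst c) A b c); auto.
- rewrite p_inst; apply oeq_sym, sub_id.
- apply oeq_sym, q_inst.
Qed.

Lemma path_ap {Γ} {A B : Ty Γ} (g : Tm B[[p A]]) (a b : Tm A) (u v : Tm B) :
  u ≡ g[<inst a>] -> v ≡ g[<inst b>] -> path a b -> path u v.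
Proof.
intros eu ev h.
apply (@path_sub _ _ _ u[<p A>] g (inst b)); auto.
{ apply oeq_sym, sub_p_inst. }
apply (@transport Γ Γ A a (inst b) A a b); auto.
- rewrite p_inst; apply oeq_sym, sub_id.
- apply oeq_sym, q_inst.
- apply path_sub with (3 := path_refl u); auto.
  apply oeq_sym, sub_p_inst.
Qed.

Lemma pointed_hom {Δ} {A : Ty Δ} (a : Tm A) (I : Ty (ext A))
    (ρ : Tm I[[inst a]]) :
  exists r : Hom Δ (ext I), p I ∘ r = inst a /\ (q I)[<r>] ≡ ρ.
Proof. now apply hom_into_ext. Qed.

(** Elimination with motive [J[[p I]]] and value [π] at reflexivity; [u] is the value [f[<r>]] in
    its simplified type. *)
Lemma id_family_map {Δ} {A : Ty Δ} {a : Tm A} {I J : Ty (ext A)}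
    {ρ : Tm I[[inst a]]} (π : Tm J[[inst a]]) (r : Hom Δ (ext I)) :
  is_id_family ρ -> p I ∘ r = inst a -> (q I)[<r>] ≡ ρ ->
  exists f : Tm J[[p I]], forall u : Tm J[[inst a]], u ≡ f[<r>] -> path π u.
Proof.
intros h pr qr.
assert (e : J[[p I]][[r]] = J[[inst a]]) by now rewrite <- tsub_comp, pr.
destruct (retype π (eq_sym e)) as [d ed].
destruct (h r pr qr _ d) as [f hf].
exists f; intros u eu.
exact (path_oeq ed (oeq_sym eu) hf).
Qed.

(** The composite and the identity of [I] agree at [ρ]; eliminating into the family of paths between
    them extends this to all of [I]. *)
Lemma id_family_retract {Δ} {A : Ty Δ} {a : Tm A} {I J : Ty (ext A)}
    {ρ : Tm I[[inst a]]} {π : Tm J[[inst a]]}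
    (r : Hom Δ (ext I)) (s : Hom Δ (ext J)) (f : Tm J[[p I]]) (g : Tm I[[p J]]) :
  is_id_family ρ ->
  p I ∘ r = inst a -> (q I)[<r>] ≡ ρ -> p J ∘ s = inst a -> (q J)[<s>] ≡ π ->
  (forall u : Tm J[[inst a]], u ≡ f[<r>] -> path π u) ->
  (forall u : Tm I[[inst a]], u ≡ g[<s>] -> path ρ u) ->
  path (fun_comp g f) (q I).
Proof.
intros h pr qr ps qs hf hg.
assert (ef : J[[p I]][[r]] = J[[inst a]]) by now rewrite <- tsub_comp, pr.
assert (eg : I[[p J]][[s]] = I[[inst a]]) by now rewrite <- tsub_comp, ps.
assert (eh : I[[p I]][[r]] = I[[inst a]]) by now rewrite <- tsub_comp, pr.
destruct (retype f[<r>] ef) as [fr efr].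
destruct (retype g[<s>] eg) as [gs egs].
destruct (retype (fun_comp g f)[<r>] eh) as [gfr egfr].
(* [g'] is [g] restricted to the fibre of [J] over [a], so that [path_ap] can be used in context
   Δ. *)
assert (el : I[[p J]][[lift (inst a) J]] = I[[inst a]][[p J[[inst a]]]]).
{ now rewrite <- !tsub_comp, p_lift. }
destruct (retype g[<lift (inst a) J>] el) as [g' eg'].
(* Up to paths, [g] of [f] of [ρ] is [g] of [π], which is [ρ]. *)
assert (d : path gfr ρ).
{ apply path_sym, path_trans with gs; [now apply hg|].
  apply path_ap with (g := g') (a := π) (b := fr); [ | |now apply hf].
  - unfold oeq in *.
    rewrite egs, (sub_vsub g'), eg', !sub_vsub, <- vsub_comp; f_equal.
    apply hom_ext_eq.
    + now rewrite <- comp_assoc, p_lift, comp_assoc, p_inst, comp_id_r.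
    + rewrite vsub_comp, q_lift_vsub, q_inst_vsub; exact qs.
  - unfold oeq in *.
    rewrite egfr, sub_vsub.
    unfold fun_comp; rewrite (rew_oeq (T := Tm) (tsub_p_pair f)).
    rewrite (sub_vsub g'), eg', !sub_vsub, <- !vsub_comp; f_equal.
    apply hom_ext_eq.
    + now rewrite <- !comp_assoc, p_lift, p_pair, comp_assoc, p_inst, comp_id_r.
    + rewrite !vsub_comp, q_lift_vsub, q_inst_vsub, efr.
      now rewrite <- (sub_vsub (q J)), (q_pair (σ := p I)). }
destruct (@path_sub _ _ _ (fun_comp g f) (q I) r _ gfr ρ) as [_ k]; auto.
{ now apply oeq_sym. }
destruct (k d) as [d'].
destruct (h r pr qr _ d') as [j _].
now constructor.
Qed.

Lemma id_families_equivalent {Δ} {A : Ty Δ} {a : Tm A} {I J : Ty (ext A)}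
    {ρ : Tm I[[inst a]]} {π : Tm J[[inst a]]} :
  is_id_family ρ -> is_id_family π -> ty_equivalent IC I J.
Proof.
intros hI hJ.
destruct (pointed_hom ρ) as (r & pr & qr).
destruct (pointed_hom π) as (s & ps & qs).
destruct (id_family_map π hI pr qr) as [f hf].
destruct (id_family_map ρ hJ ps qs) as [g hg].
exists f, g; split.
- now apply (id_family_retract (r := r) (s := s) (ρ := ρ) (π := π)).
- now apply (id_family_retract (r := s) (s := r) (ρ := π) (π := ρ)).
Qed.

End Paths.

(** * The free syntax over C *)

Section Syntax.
Context (C : CwF).

(* [None] marks a bare type, so that types and terms share one syntax. *)
Definition sem (X : Ob C) := {T : Ty X & option (Tm T)}.

Definition sty {X : Ob C} (T : Ty X) : sem X := existT _ T None.
Definition stm {X : Ob C} {T : Ty X} (a : Tm T) : sem X := existT _ T (Some a).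

Definition ssub {Y X : Ob C} (σ : Hom Y X) (s : sem X) : sem Y :=
  existT _ (projT1 s)[[σ]] (option_map (fun a => a[<σ>]) (projT2 s)).

Lemma sty_inj {X : Ob C} (T T' : Ty X) : sty T = sty T' -> T = T'.
Proof. exact (@f_equal _ _ (fun s : sem X => projT1 s) _ _). Qed.

Lemma stm_eq {X : Ob C} {T T' : Ty X} (a : Tm T) (a' : Tm T') :
  a ≡ a' <-> stm a = stm a'.
Proof.
split; intros e.
- pose proof (oeq_ty e); subst T'; apply inj_pair2 in e; now subst.
- apply (f_equal (fun s : sem X => match projT2 s with
    | Some b => Some (existT (@Tm C X) _ b) | None => None end)) in e.
  now inversion e.
Qed.

Lemma ssub_id {X : Ob C} (s : sem X) : ssub (idh X) s = s.
Proof.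
destruct s as [T [a|] ]; cbn.
- apply stm_eq, sub_id.
- unfold ssub; cbn; now rewrite tsub_id.
Qed.

Lemma ssub_comp {X Y Z : Ob C} (σ : Hom Y X) (τ : Hom Z Y) (s : sem X) :
  ssub (σ ∘ τ) s = ssub τ (ssub σ s).
Proof.
destruct s as [T [a|] ]; cbn.
- apply stm_eq, sub_comp.
- unfold ssub; cbn; now rewrite tsub_comp.
Qed.

Lemma map_ssub_id {X : Ob C} (ρ : list (sem X)) : map (ssub (idh X)) ρ = ρ.
Proof. rewrite <- map_id; apply map_ext, ssub_id. Qed.

Lemma map_ssub_comp {X Y Z : Ob C} (σ : Hom Y X) (τ : Hom Z Y)
    (ρ : list (sem X)) :
  map (ssub (σ ∘ τ)) ρ = map (ssub τ) (map (ssub σ) ρ).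
Proof. rewrite map_map; apply map_ext; intros; apply ssub_comp. Qed.

Record sym := Sym { sX : Ob C; sρ : list (sem sX); sv : sem sX }.

(* A node [app W k c ts] applies a generator living in the context W,
   interpreted by the object [sX c] with variables [sρ c], to arguments for W.
   It is a type generator if k is [None] and a term generator of type B if k is
   [Some B]; its value in C is [sv c].  Variables are de Bruijn indices, and
   [bot] fills the positions outside the range of a list of arguments. *)
Inductive expr :=
| var (n : nat)
| bot
| app (W : list expr) (k : option expr) (c : sym) (ts : list expr).

(** No hypothesis is offered for [W] and [k]: they are annotations naming the generator, which
    [subst], [scoped] and [interp] never enter. *)
Definition expr_nested_ind (P : expr -> Prop) (hv : forall n, P (var n))
    (hb : P bot)
    (ha : forall W k c ts, Forall P ts -> P (app W k c ts)) :
    forall e, P e :=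
  fix go e := match e with
  | var n => hv n
  | bot => hb
  | app W k c ts => ha W k c ts
      ((fix gos ts : Forall P ts := match ts with
        | [] => Forall_nil P
        | t :: ts => Forall_cons t (go t) (gos ts)
        end) ts)
  end.

Fixpoint subst (s : nat -> expr) (e : expr) : expr :=
  match e with
  | var n => s n
  | bot => bot
  | app W k c ts => app W k c (map (subst s) ts)
  end.

Definition of (ts : list expr) (n : nat) : expr := nth n ts bot.
Definition shift (k n : nat) : expr := var (k + n).
Definition ids (n : nat) : list expr := map var (seq 0 n).

Fixpoint scoped (N : nat) (e : expr) : Prop :=
  match e with
  | var n => n < N
  | bot => False
  | app _ _ _ ts => fold_right (fun t P => scoped N t /\ P) True ts
  end.

Lemma scoped_app N W k c ts : scoped N (app W k c ts) <-> Forall (scoped N) ts.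
Proof.
cbn; induction ts as [|t ts IH]; cbn; [now split|].
rewrite Forall_cons_iff; tauto.
Qed.

Lemma subst_subst s r e : subst s (subst r e) = subst (fun n => subst s (r n)) e.
Proof.
induction e as [n| |W k c ts IH] using expr_nested_ind; cbn; auto.
f_equal; rewrite map_map; now apply map_ext_Forall.
Qed.

Lemma subst_scoped N s s' e :
  scoped N e -> (forall n, n < N -> s n = s' n) -> subst s e = subst s' e.
Proof.
intros he h; induction e as [n| |W k c ts IH] using expr_nested_ind; cbn; auto.
apply scoped_app in he; f_equal.
apply map_ext_Forall; rewrite Forall_forall in *; auto.
Qed.

Lemma subst_ext s s' e : (forall n, s n = s' n) -> subst s e = subst s' e.
Proof. intros h; f_equal; now apply functional_extensionality. Qed.

Lemma subst_var e : subst var e = e.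
Proof.
induction e as [n| |W k c ts IH] using expr_nested_ind; cbn; auto.
f_equal; rewrite <- (map_id ts) at 2; now apply map_ext_Forall.
Qed.

Lemma of_map s ts n : of (map (subst s) ts) n = subst s (of ts n).
Proof. exact (map_nth (subst s) ts bot n). Qed.

Lemma subst_of s ts e : subst s (subst (of ts) e) = subst (of (map (subst s) ts)) e.
Proof. rewrite subst_subst; apply subst_ext; intros; now rewrite of_map. Qed.

Lemma length_ids n : length (ids n) = n.
Proof. unfold ids; now rewrite length_map, length_seq. Qed.

Lemma of_map_var l n : n < length l -> of (map var l) n = var (nth n l 0).
Proof.
intros h; unfold of.
rewrite nth_indep with (d' := var 0) by now rewrite length_map.
apply map_nth.
Qed.

Lemma of_ids N n : n < N -> of (ids N) n = var n.
Proof.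
intros h; unfold ids; rewrite of_map_var by now rewrite length_seq.
now rewrite seq_nth.
Qed.

Lemma subst_ids N e : scoped N e -> subst (of (ids N)) e = e.
Proof.
intros h; rewrite <- (subst_var e) at 2.
apply subst_scoped with (1 := h); intros; now apply of_ids.
Qed.

Lemma map_of_ids s ts : length ts = s -> map (subst (of ts)) (ids s) = ts.
Proof.
intros <-; unfold ids; rewrite map_map; cbn.
apply nth_ext with bot bot; rewrite !length_map, length_seq; auto.
intros n h.
rewrite nth_indep with (d' := of ts 0) by now rewrite length_map, length_seq.
now rewrite map_nth, seq_nth.
Qed.

(** A relation, since the map [σ] at a node can only be assembled from the arguments once they are
    known to be well typed. [interp_fun] and [sound] make it a function on typed expressions. The
    inner fixpoint is [Forall2], spelled out to keep the recursion structural. *)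
Fixpoint interp {X : Ob C} (ρ : list (sem X)) (e : expr) (s : sem X) : Prop :=
  match e with
  | var n => nth_error ρ n = Some s
  | bot => False
  | app W k c ts => exists σ : Hom X (sX c),
      (fix all ts l := match ts, l with
       | [], [] => True
       | t :: ts, x :: l => interp ρ t x /\ all ts l
       | _, _ => False
       end) ts (map (ssub σ) (sρ c)) /\ s = ssub σ (sv c)
  end.

Lemma interp_app {X : Ob C} (ρ : list (sem X)) W k c ts s :
  interp ρ (app W k c ts) s <-> exists σ : Hom X (sX c),
    Forall2 (interp ρ) ts (map (ssub σ) (sρ c)) /\ s = ssub σ (sv c).
Proof.
cbn.
assert (h : forall l, (fix all ts l := match ts, l with
       | [], [] => True
       | t :: ts, x :: l => interp ρ t x /\ all ts l
       | _, _ => False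
       end) ts l <-> Forall2 (interp ρ) ts l).
{ induction ts as [|t ts IH]; intros [|x l]; split; try easy.
  - intros [h1 h2]; constructor; auto; now apply IH.
  - intros h; inversion h; subst; split; auto; now apply IH. }
split; intros (σ & h1 & h2); exists σ; split; auto; now apply h.
Qed.

Definition ok (k : option expr) (c : sym) : Prop :=
  match k with
  | None => projT2 (sv c) = None
  | Some B => exists (T : Ty (sX c)) (a : Tm T),
      sv c = stm a /\ interp (sρ c) B (sty T)
  end.

(* Types are assigned [None] and terms their type; [wfc Γ ρ] says that Γ is a
   context interpreted by the object underlying ρ, with variables ρ. *)
Inductive wt : list expr -> expr -> option expr -> Prop :=
| wt_var Γ n A : nth_error Γ n = Some A ->
    wt Γ (var n) (Some (subst (shift (S n)) A))
| wt_app Γ W k c ts : wfc W (sρ c) ->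
    (forall B, k = Some B -> wt W B None) -> ok k c ->
    length ts = length W ->
    (forall n A, nth_error W n = Some A ->
       wt Γ (of ts n) (Some (subst (of ts) (subst (shift (S n)) A)))) ->
    wt Γ (app W k c ts) (option_map (subst (of ts)) k)
with wfc : list expr -> forall X : Ob C, list (sem X) -> Prop :=
| wfc_nil : wfc [] (X := emp) []
| wfc_cons Γ X (ρ : list (sem X)) A (T : Ty X) :
    wfc Γ ρ -> wt Γ A None -> interp ρ A (sty T) ->
    wfc (A :: Γ) (stm (q T) :: map (ssub (p T)) ρ).

Scheme wfc_only_ind := Minimality for wfc Sort Prop.

Definition wsub (Δ : list expr) (s : nat -> expr) (Γ : list expr) : Prop :=
  forall n A, nth_error Γ n = Some A ->
  wt Δ (s n) (Some (subst s (subst (shift (S n)) A))).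

(** The rules are syntax-directed, so facts about typing go by induction on the expression together
    with this inversion. *)
Lemma wt_inv Γ e o : wt Γ e o -> match e with
  | var n => exists A, nth_error Γ n = Some A /\ o = Some (subst (shift (S n)) A)
  | bot => False
  | app W k c ts => wfc W (sρ c) /\ (forall B, k = Some B -> wt W B None) /\
      ok k c /\ length ts = length W /\ wsub Γ (of ts) W /\
      o = option_map (subst (of ts)) k
  end.
Proof. intros []; [now exists A|]; now repeat split. Qed.

Lemma wt_unique Γ e o o' : wt Γ e o -> wt Γ e o' -> o = o'.
Proof.
intros h h'; apply wt_inv in h, h'; destruct e; [|easy|].
- destruct h as (A & h & ->), h' as (A' & h' & ->); congruence.
- now destruct h as (_ & _ & _ & _ & _ & ->), h' as (_ & _ & _ & _ & _ & ->).
Qed.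

Lemma wsub_args Γ W ts : length ts = length W -> wsub Γ (of ts) W ->
  Forall (fun t => exists A, wt Γ t (Some A)) ts.
Proof.
intros el h; apply Forall_nth; intros n d hn.
destruct (nth_error W n) as [A|] eqn:e.
- rewrite nth_indep with (d' := bot) by auto; eexists; exact (h n A e).
- apply nth_error_None in e; lia.
Qed.

Lemma wt_scoped Γ e o : wt Γ e o -> scoped (length Γ) e.
Proof.
revert o; induction e as [n| |W k c ts IH] using expr_nested_ind;
  intros o h; apply wt_inv in h; [|easy|].
- destruct h as (A & h & _); apply nth_error_Some; congruence.
- destruct h as (_ & _ & _ & el & h & _); apply scoped_app.
  apply wsub_args in h; auto.
  rewrite Forall_forall in *; intros t ht.
  destruct (h t ht) as [A hA]; eauto.
Qed.

Lemma wt_subst Γ e o Δ s :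
  wt Γ e o -> wsub Δ s Γ -> wt Δ (subst s e) (option_map (subst s) o).
Proof.
revert o; induction e as [n| |W k c ts IH] using expr_nested_ind;
  intros o h hs; apply wt_inv in h; [|easy|].
- destruct h as (A & h & ->); now apply hs.
- destruct h as (hW & hk & hc & el & h & ->); cbn.
  replace (option_map (subst s) (option_map (subst (of ts)) k))
    with (option_map (subst (of (map (subst s) ts))) k)
    by (destruct k; cbn; f_equal; symmetry; apply subst_of).
  constructor; auto; [now rewrite length_map|].
  intros n A hn; rewrite of_map, <- subst_of.
  assert (hi : In (of ts n) ts).
  { apply nth_In; rewrite el; apply nth_error_Some; congruence. }
  rewrite Forall_forall in IH.
  exact (IH _ hi _ (h n A hn) hs).
Qed.

Lemma wsub_shift Ξ Γ : wsub (Ξ ++ Γ) (shift (length Ξ)) Γ.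
Proof.
intros n A h.
replace (subst (shift (length Ξ)) (subst (shift (S n)) A))
  with (subst (shift (S (length Ξ + n))) A).
- apply wt_var; rewrite nth_error_app2 by lia.
  now replace (length Ξ + n - length Ξ) with n by lia.
- rewrite subst_subst; apply subst_ext; intros m; cbn; unfold shift; f_equal; lia.
Qed.

Lemma wsub_comp Γ Δ Θ s r :
  wsub Δ s Γ -> wsub Θ r Δ -> wsub Θ (fun n => subst r (s n)) Γ.
Proof.
intros hs hr n A h.
rewrite <- (subst_subst r s).
exact (wt_subst (hs n A h) hr).
Qed.

Lemma wt_weaken Ξ Γ e o : wt Γ e o ->
  wt (Ξ ++ Γ) (subst (shift (length Ξ)) e)
    (option_map (subst (shift (length Ξ))) o).
Proof. intros h; apply wt_subst with (1 := h), wsub_shift. Qed.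

Lemma subst_shift_shift j k e :
  subst (shift j) (subst (shift k) e) = subst (shift (j + k)) e.
Proof.
rewrite subst_subst; apply subst_ext; intros n; cbn; unfold shift; f_equal; lia.
Qed.

Lemma wfc_nth Γ X (ρ : list (sem X)) n A :
  wfc Γ ρ -> nth_error Γ n = Some A -> wt Γ (subst (shift (S n)) A) None.
Proof.
intros h; revert n; induction h as [|Γ X ρ B T hΓ IH hB hi] using wfc_only_ind;
  intros [|n] e; cbn in e; try easy.
- injection e as ->; exact (wt_weaken [A] hB).
- apply IH, (wt_weaken [B]) in e; cbn in e.
  now rewrite subst_shift_shift in e.
Qed.

Lemma wt_type Γ X (ρ : list (sem X)) e A :
  wfc Γ ρ -> wt Γ e (Some A) -> wt Γ A None.
Proof.
intros h he; apply wt_inv in he; destruct e; [|easy|].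
- destruct he as (B & hn & [= ->]); eapply wfc_nth; eauto.
- destruct he as (hW & hk & _ & _ & hs & eo).
  destruct k as [B|]; [|easy]; injection eo as ->.
  exact (wt_subst (hk B eq_refl) hs).
Qed.

(** * Functionality and soundness of the interpretation *)

Lemma interp_sub {X Y : Ob C} (σ : Hom Y X) (ρ : list (sem X)) e s :
  interp ρ e s -> interp (map (ssub σ) ρ) e (ssub σ s).
Proof.
revert s; induction e as [n| |W k c ts IH] using expr_nested_ind; intros s h.
- cbn in *; now apply map_nth_error.
- easy.
- apply interp_app in h; destruct h as (τ & h & ->).
  apply interp_app; exists (τ ∘ σ); split; [|now rewrite ssub_comp].
  rewrite map_ssub_comp.
  revert h; generalize (map (ssub τ) (sρ c)).
  induction IH as [|t ts' ht _ IHts]; intros l h; inversion h; subst; constructor; auto.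
Qed.

Lemma interp_subst {X : Ob C} (ρ ρ' : list (sem X)) r e s :
  interp ρ e s ->
  (forall n x, nth_error ρ n = Some x -> interp ρ' (r n) x) ->
  interp ρ' (subst r e) s.
Proof.
intros h hr; revert s h; induction e as [n| |W k c ts IH] using expr_nested_ind;
  intros s h.
- now apply hr.
- easy.
- apply interp_app in h; destruct h as (τ & h & ->).
  cbn [subst]; apply interp_app; exists τ; split; auto.
  revert h; generalize (map (ssub τ) (sρ c)).
  induction IH as [|t ts' ht _ IHts]; intros l h; inversion h; subst; constructor; auto.
Qed.

Lemma Forall2_nth {X : Ob C} (ρ : list (sem X)) ts l n x :
  Forall2 (interp ρ) ts l -> nth_error l n = Some x -> interp ρ (of ts n) x.
Proof.
intros h; revert n; induction h; intros [|n] e; cbn in *; try easy.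
- now injection e as ->.
- now apply IHh.
Qed.

Lemma interp_subst_of {X Y : Ob C} (ρ : list (sem X)) (ρ' : list (sem Y))
    (σ : Hom Y X) ts e s :
  interp ρ e s -> Forall2 (interp ρ') ts (map (ssub σ) ρ) ->
  interp ρ' (subst (of ts) e) (ssub σ s).
Proof.
intros h hts; apply interp_subst with (1 := interp_sub σ h).
intros n x; now apply Forall2_nth.
Qed.

Lemma interp_shift {X Y : Ob C} (σ : Hom Y X) (ρ : list (sem X)) ν e s :
  interp ρ e s ->
  interp (ν ++ map (ssub σ) ρ) (subst (shift (length ν)) e) (ssub σ s).
Proof.
intros h; apply interp_subst with (1 := interp_sub σ h).
intros n x hn; cbn.
rewrite nth_error_app2 by lia.
now replace (length ν + n - length ν) with n by lia.
Qed.

Lemma ids_interp {X : Ob C} (ρ : list (sem X)) :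
  Forall2 (interp ρ) (ids (length ρ)) ρ.
Proof.
enough (h : forall ν μ, ρ = ν ++ μ ->
  Forall2 (interp ρ) (map var (seq (length ν) (length μ))) μ)
  by exact (h [] ρ eq_refl).
intros ν μ; revert ν; induction μ as [|x μ IH]; intros ν e; cbn; constructor.
- cbn; subst; now rewrite nth_error_app2, Nat.sub_diag by lia.
- specialize (IH (ν ++ [x])); rewrite length_app, Nat.add_1_r in IH.
  apply IH; now rewrite <- app_assoc.
Qed.

Lemma wfc_length Γ X (ρ : list (sem X)) : wfc Γ ρ -> length ρ = length Γ.
Proof.
intros h; induction h as [|Γ X ρ B T hΓ IH hB hi] using wfc_only_ind; cbn; auto.
now rewrite length_map, IH.
Qed.

(** The variables of a context are jointly monic, because each comprehension is detected by [p] and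
    [q]. Functionality of [interp] and extensionality of the morphisms of [D] rest on this. *)
Lemma wfc_mono Γ X (ρ : list (sem X)) : wfc Γ ρ ->
  forall Y (σ τ : Hom Y X), map (ssub σ) ρ = map (ssub τ) ρ -> σ = τ.
Proof.
intros h; induction h as [|Γ X ρ B T hΓ IH hB hi] using wfc_only_ind;
  intros Y σ τ e.
- now rewrite (bang_uniq σ), (bang_uniq τ).
- cbn [map] in e; injection e as e1 e2 e3.
  apply pair_uniq.
  + apply IH; now rewrite !map_ssub_comp.
  + exact e2.
Qed.

Lemma interp_fun Γ X (ρ : list (sem X)) e o s s' :
  wt Γ e o -> interp ρ e s -> interp ρ e s' -> s = s'.
Proof.
revert o s s'; induction e as [n| |W k c ts IH] using expr_nested_ind;
  intros o s s' he h h'; [cbn in *; congruence|easy|].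
apply wt_inv in he; destruct he as (hW & _ & _ & el & hs & _).
apply interp_app in h, h'.
destruct h as (σ & h & ->), h' as (τ & h' & ->).
replace τ with σ; auto.
apply (wfc_mono hW).
apply wsub_args in hs; auto; clear el.
revert h h'.
generalize (map (ssub σ) (sρ c)), (map (ssub τ) (sρ c)).
induction IH as [|t ts' ht _ IHts]; intros l l' h h'; inversion h; inversion h';
  inversion hs; subst; auto.
f_equal; auto.
destruct H11 as [A hA]; eauto.
Qed.

Definition typed_value {X : Ob C} (ρ : list (sem X)) (o : option expr)
    (s : sem X) : Prop :=
  match o with
  | None => projT2 s = None
  | Some B => exists (T : Ty X) (a : Tm T), s = stm a /\ interp ρ B (sty T)
  end.

Lemma wfc_nth_value Γ X (ρ : list (sem X)) n A :
  wfc Γ ρ -> nth_error Γ n = Some A ->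
  exists s, nth_error ρ n = Some s /\
    typed_value ρ (Some (subst (shift (S n)) A)) s.
Proof.
intros h; revert n; induction h as [|Γ X ρ B T hΓ IH hB hi] using wfc_only_ind;
  intros [|n] e; cbn [nth_error] in *; try easy.
- injection e as ->; eexists; split; [reflexivity|].
  eexists _, _; split; [reflexivity|].
  exact (interp_shift (p T) [stm (q T)] hi).
- apply IH in e; destruct e as (s & hn & U & a & -> & hU).
  exists (ssub (p T) (stm a)); split; [now apply map_nth_error|].
  exists U[[p T]], a[<p T>]; split; auto.
  apply (interp_shift (p T) [stm (q T)]) in hU.
  now rewrite subst_shift_shift in hU.
Qed.

Lemma subst_of_cons t ts e :
  subst (of (t :: ts)) (subst (shift 1) e) = subst (of ts) e.
Proof. rewrite subst_subst; now apply subst_ext. Qed.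

(** The map is built by iterated pairing, one argument per variable of [W]. *)
Lemma sound_args Γ X (ρ : list (sem X)) W Y (ρ' : list (sem Y)) ts :
  wfc W ρ' -> length ts = length W -> wsub Γ (of ts) W ->
  Forall (fun t => forall B, wt Γ t (Some B) ->
    exists s, interp ρ t s /\ typed_value ρ (Some B) s) ts ->
  exists σ : Hom X Y, Forall2 (interp ρ) ts (map (ssub σ) ρ').
Proof.
intros h; revert ts; induction h as [|W Y ρ' B T hW IH hB hi] using wfc_only_ind;
  intros [|t ts] el hs hts; try easy.
- exists (bang X); constructor.
- inversion hts as [|t' ts' ht hts']; subst.
  assert (hs' : wsub Γ (of ts) W).
  { intros n A hn; pose proof (hs (S n) A hn) as ht'.
    change (S (S n)) with (1 + S n) in ht'.
    now rewrite <- subst_shift_shift, subst_of_cons in ht'. }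
  destruct (IH ts) as [σ hσ]; auto.
  pose proof (hs 0 B eq_refl) as h0; cbn in h0.
  rewrite subst_of_cons in h0.
  destruct (ht _ h0) as (s & hi' & U & a & -> & hU).
  (* Both types interpret the same expression, [B] instantiated by [ts], so they coincide by
     functionality. *)
  assert (eT : U = T[[σ]]).
  { apply sty_inj; apply (interp_fun (wt_subst hB hs') hU).
    exact (interp_subst_of hi hσ). }
  subst U; exists (pair σ a); cbn [map]; constructor.
  + replace (ssub (pair σ a) (stm (q T))) with (stm a); auto.
    apply stm_eq, oeq_sym, q_pair.
  + now rewrite <- map_ssub_comp, p_pair.
Qed.

Lemma sound Γ X (ρ : list (sem X)) e o :
  wfc Γ ρ -> wt Γ e o -> exists s, interp ρ e s /\ typed_value ρ o s.
Proof.
intros hΓ; revert o; induction e as [n| |W k c ts IH] using expr_nested_ind;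
  intros o h; apply wt_inv in h; [|easy|].
- destruct h as (A & h & ->); exact (wfc_nth_value hΓ h).
- destruct h as (hW & hk & hc & el & hs & ->).
  destruct (@sound_args Γ X ρ W _ _ ts hW el hs) as [σ hσ].
  { revert IH; apply Forall_impl; auto. }
  exists (ssub σ (sv c)); split; [apply interp_app; now exists σ|].
  destruct k as [B|]; cbn in *.
  + destruct hc as (T & a & -> & hT).
    exists T[[σ]], a[<σ>]; split; auto.
    exact (interp_subst_of hT hσ).
  + now rewrite hc.
Qed.

Lemma sound_ty Γ X (ρ : list (sem X)) A :
  wfc Γ ρ -> wt Γ A None -> exists T : Ty X, interp ρ A (sty T).
Proof.
intros hΓ h; destruct (sound hΓ h) as ([T o] & hi & ho); cbn in ho; subst.
now exists T.
Qed.

Lemma sound_tm Γ X (ρ : list (sem X)) A (T : Ty X) t :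
  wfc Γ ρ -> interp ρ A (sty T) -> wt Γ t (Some A) ->
  exists a : Tm T, interp ρ t (stm a).
Proof.
intros hΓ hA h; destruct (sound hΓ h) as (s & hi & U & a & -> & hU).
assert (e : U = T) by (apply sty_inj; exact (interp_fun (wt_type hΓ h) hU hA)).
subst U; now exists a.
Qed.

Lemma wsub_cons Δ t ts B W :
  wt Δ t (Some (subst (of ts) B)) -> wsub Δ (of ts) W ->
  wsub Δ (of (t :: ts)) (B :: W).
Proof.
intros ht hts [|n] A hn; cbn in hn.
- injection hn as ->; now rewrite subst_of_cons.
- change (S (S n)) with (1 + S n).
  rewrite <- subst_shift_shift, subst_of_cons; now apply hts.
Qed.

Lemma wsub_uncons Δ t ts B W :
  wsub Δ (of (t :: ts)) (B :: W) ->
  wt Δ t (Some (subst (of ts) B)) /\ wsub Δ (of ts) W.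
Proof.
intros h; split.
- pose proof (h 0 B eq_refl) as h0; now rewrite subst_of_cons in h0.
- intros n A hn; pose proof (h (S n) A hn) as ht.
  change (S (S n)) with (1 + S n) in ht.
  now rewrite <- subst_shift_shift, subst_of_cons in ht.
Qed.

Lemma wsub_scoped_ext Γ X (ρ : list (sem X)) Δ s s' :
  wfc Γ ρ -> (forall n, n < length Γ -> s n = s' n) ->
  wsub Δ s Γ -> wsub Δ s' Γ.
Proof.
intros hΓ e h n A hn.
rewrite <- e by (apply nth_error_Some; congruence).
rewrite <- (subst_scoped (s := s) (N := length Γ)); auto.
exact (wt_scoped (wfc_nth hΓ hn)).
Qed.

Lemma wsub_var Γ : wsub Γ var Γ.
Proof. exact (@wsub_shift [] Γ). Qed.

Lemma wsub_ids Γ X (ρ : list (sem X)) :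
  wfc Γ ρ -> wsub Γ (of (ids (length Γ))) Γ.
Proof.
intros hΓ; apply wsub_scoped_ext with (1 := hΓ) (3 := @wsub_var Γ).
intros n hn; now rewrite of_ids.
Qed.

End Syntax.

Arguments var {C}.
Arguments bot {C}.
Arguments of {C}.
Arguments shift {C}.
Arguments ids {C}.

(** * Generic forms of families of expressions *)

Section Up.
Context (C : CwF).
Notation expr := (expr C).

Definition wf (Γ : list expr) : Prop := exists (X : Ob C) (ρ : list (sem X)), wfc Γ ρ.

Lemma wf_cons Γ (A : expr) : wf Γ -> wt Γ A None -> wf (A :: Γ).
Proof.
intros (X & ρ & h) hA; destruct (sound_ty h hA) as [T hT].
exists (ext T); eexists; econstructor; eauto.
Qed.

Lemma wf_tail Γ (A : expr) : wf (A :: Γ) -> wf Γ /\ wt Γ A None.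
Proof.
intros (X & ρ & h); inversion h; subst; split; auto.
now exists X0, ρ0.
Qed.

Definition scomp (r s : nat -> expr) (n : nat) : expr := subst s (r n).

Lemma subst_scomp s r (e : expr) : subst s (subst r e) = subst (scomp r s) e.
Proof. apply subst_subst. Qed.

Definition up (m : nat) (s : nat -> expr) (n : nat) : expr :=
  if n <? m then var n else subst (shift m) (s (n - m)).

Lemma up_lt m s n : n < m -> up m s n = var n.
Proof. intros h; unfold up; apply Nat.ltb_lt in h; now rewrite h. Qed.

Lemma up_add m s n : up m s (m + n) = subst (shift m) (s n).
Proof.
unfold up; destruct (Nat.ltb_spec (m + n) m); [lia|].
now replace (m + n - m) with n by lia.
Qed.

Lemma lt_or_add m n : n < m \/ exists j, n = m + j.
Proof. destruct (le_lt_dec m n); [right; exists (n - m); lia | now left]. Qed.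

Lemma scomp_up m r s : scomp (up m r) (up m s) = up m (scomp r s).
Proof.
apply functional_extensionality; intros n; unfold scomp.
destruct (lt_or_add m n) as [h|[j ->] ].
- rewrite !up_lt by auto; cbn; now apply up_lt.
- rewrite !up_add, !subst_subst; apply subst_ext; intros i; cbn.
  now rewrite up_add.
Qed.

Lemma up_var m : up m var = var.
Proof.
apply functional_extensionality; intros n.
destruct (lt_or_add m n) as [h|[j ->] ]; [now apply up_lt | now rewrite up_add].
Qed.

Lemma scomp_shift m s : scomp (shift m) (up m s) = scomp s (shift m).
Proof.
apply functional_extensionality; intros n; unfold scomp; cbn; apply up_add.
Qed.

Lemma subst_up_shift m s (e : expr) :
  subst (up m s) (subst (shift m) e) = subst (shift m) (subst s e).
Proof. now rewrite !subst_scomp, scomp_shift. Qed.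

Lemma subst_up_up m r s (e : expr) :
  subst (up m s) (subst (up m r) e) = subst (up m (scomp r s)) e.
Proof. now rewrite subst_scomp, scomp_up. Qed.

Lemma unshift m (e : expr) : subst (fun n => var (n - m)) (subst (shift m) e) = e.
Proof.
rewrite subst_subst; transitivity (subst var e); [|apply subst_var].
apply subst_ext; intros n; cbn; f_equal; lia.
Qed.

Lemma shift_inj m (e e' : expr) :
  subst (shift m) e = subst (shift m) e' -> e = e'.
Proof. intros h; now rewrite <- (unshift m e), h, unshift. Qed.

(* The subterms avoiding the first m variables are collapsed to [bot]. *)
Fixpoint skel (m : nat) (e : expr) : expr :=
  match e with
  | var n => if n <? m then var n else bot
  | bot => bot
  | app W k c ts =>
      if forallb (fun t => match skel m t with bot => true | _ => false end) ts
      then bot else app W k c (map (skel m) ts)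
  end.

Lemma skel_lt m n : n < m -> skel m (var n) = var n.
Proof. intros h; simpl; apply Nat.ltb_lt in h; now rewrite h. Qed.

Lemma skel_add m n : skel m (var (m + n)) = bot.
Proof. simpl; destruct (Nat.ltb_spec (m + n) m); auto; lia. Qed.

Lemma skel_app m W k c (ts : list expr) :
  skel m (app W k c ts) = bot /\ (forall t, In t ts -> skel m t = bot) \/
  skel m (app W k c ts) = app W k c (map (skel m) ts).
Proof.
cbn; match goal with |- context [if ?b then _ else _] => destruct b eqn:e end.
- left; split; auto; intros t ht.
  rewrite forallb_forall in e; specialize (e t ht); now destruct (skel m t).
- now right.
Qed.

Lemma skel_app_bot m W k c (ts : list expr) :
  (forall t, In t ts -> skel m t = bot) -> skel m (app W k c ts) = bot.
Proof.
intros h; cbn; rewrite (proj2 (forallb_forall _ _)); auto.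
intros t ht; now rewrite h.
Qed.

Lemma skel_shift m (e : expr) : skel m (subst (shift m) e) = bot.
Proof.
induction e as [n| |W k c ts IH] using expr_nested_ind; auto.
- apply skel_add.
- apply skel_app_bot; intros t ht; apply in_map_iff in ht.
  destruct ht as (t' & <- & ht); rewrite Forall_forall in IH; auto.
Qed.

Lemma skel_up m s (e : expr) : skel m (subst (up m s) e) = skel m e.
Proof.
induction e as [n| |W k c ts IH] using expr_nested_ind; auto.
- destruct (lt_or_add m n) as [h|[j ->] ].
  + cbn [subst]; now rewrite up_lt.
  + cbn [subst]; now rewrite up_add, skel_shift, skel_add.
- cbn; rewrite map_map; rewrite (map_ext_Forall _ _ IH).
  replace (forallb _ (map (subst (up m s)) ts)) with
    (forallb (fun t => match skel m t with bot => true | _ => false end) ts); auto.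
  clear - IH; induction IH as [|t ts ht _ IHts]; cbn; auto.
  now rewrite ht, IHts.
Qed.

(** An expression avoiding the bound variables descends along any section [s] of the projection and
    is recovered by weakening. *)
Lemma skel_bot m N s (e : expr) : skel m e = bot -> scoped N e ->
  (forall n, s (m + n) = var n) ->
  subst (shift m) (subst s e) = e.
Proof.
intros he hN hs; induction e as [n| |W k c ts IH] using expr_nested_ind; auto.
- destruct (lt_or_add m n) as [h|[j ->] ].
  + now rewrite skel_lt in he.
  + cbn; now rewrite hs.
- destruct (skel_app m W k c ts) as [ [_ h]|h]; [|congruence].
  apply scoped_app in hN.
  cbn; f_equal; rewrite map_map, <- (map_id ts) at 1.
  rewrite map_id; rewrite <- (map_id ts) at 2.
  apply map_ext_Forall; rewrite Forall_forall in *; auto.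
Qed.

(** A skeleton [bot] forgets the arguments, but then all of them have skeleton [bot] and the two
    lists agree by length. *)
Lemma same_skel_args m W k c (ts us : list expr) :
  length ts = length us -> skel m (app W k c ts) = skel m (app W k c us) ->
  map (skel m) ts = map (skel m) us.
Proof.
intros el h.
destruct (skel_app m W k c ts) as [ [e h1]|e], (skel_app m W k c us) as [ [e' h2]|e'];
  try congruence.
clear - h1 h2 el; revert us el h2.
induction ts as [|t ts IH]; intros [|u us] el h2; try easy; cbn in *.
f_equal; [rewrite h1, h2; auto | apply IH; auto].
Qed.

(* Telescopes over contexts equipped with a substitution h into a fixed base,
   stable under substitution, and with a section of the projection. *)
Record frame := {
  fb : list expr;
  fm : nat;
  ftel : (nat -> expr) -> list expr;
  fsec : (nat -> expr) -> nat -> expr;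
  ftel_length : forall h, length (ftel h) = fm;
  ftel_wf : forall Γ h, wf Γ -> wsub Γ h fb -> wf (ftel h ++ Γ);
  ftel_up : forall Γ Δ h s, wsub Γ h fb -> wsub Δ s Γ ->
    wsub (ftel (scomp h s) ++ Δ) (up fm s) (ftel h ++ Γ);
  fsec_wsub : forall Γ h, wsub Γ h fb -> wsub Γ (fsec h) (ftel h ++ Γ);
  fsec_scomp : forall h s n, n < fm -> fsec (scomp h s) n = subst s (fsec h n);
  fsec_add : forall h n, fsec h (fm + n) = var n
}.

End Up.

(** * Anti-unification of families of typed expressions *)

Section Generic.
Context (C : CwF) (F : frame C) (I : Type) (i0 : I) (Δ : I -> list (expr C)).
Notation expr := (expr C).
Notation m := (fm F).
Notation tel := (ftel F).
Notation sec := (fsec F).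

Definition same_head (b : I -> expr) : Prop :=
  exists W k c, forall i, exists ts, b i = app W k c ts.

(* The last two clauses make the family γ jointly injective on expressions over
   Γ (stage_faithful): no variable can be refined, and no two identified. *)
Definition stage (Γ : list expr) (γ : I -> nat -> expr) : Prop :=
  wf Γ /\ (forall i, wsub (Δ i) (γ i) Γ) /\
  (forall n, n < length Γ -> ~ same_head (fun i => γ i n)) /\
  (forall n n', n < length Γ -> n' < length Γ ->
     (forall i, γ i n = γ i n') -> n = n').

(** Induction on [e]. A context variable matched with an application would acquire a common head. A
    bound variable is told apart at [i0]: [up m] fixes it, and weakens the values of context
    variables past it. *)
Lemma stage_faithful Γ γ (e e' : expr) : stage Γ γ ->
  scoped (m + length Γ) e -> scoped (m + length Γ) e' ->
  (forall i, subst (up m (γ i)) e = subst (up m (γ i)) e') -> e = e'.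
Proof.
intros (_ & _ & hf & hd) he he' h.
assert (hva : forall n W k c ts, n < m + length Γ ->
  (forall i, up m (γ i) n = subst (up m (γ i)) (app W k c ts)) -> False).
{ intros n W k c ts hn hi.
  destruct (lt_or_add m n) as [hm|[j ->] ].
  - specialize (hi i0); rewrite up_lt in hi by auto; discriminate hi.
  - apply (hf j); [lia|]; exists W, k, c; intros i; specialize (hi i).
    rewrite up_add in hi; cbn in hi.
    destruct (γ i j); try easy; cbn in hi; injection hi as -> -> -> _; eauto. }
revert e' he he' h; induction e as [n| |W k c ts IH] using expr_nested_ind;
  intros [n'| |W' k' c' ts'] he he' h; try easy.
- cbn in *.
  destruct (lt_or_add m n) as [hm|[j ->] ], (lt_or_add m n') as [hm'|[j' ->] ].
  + specialize (h i0); now rewrite !up_lt in h.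
  + exfalso; specialize (h i0); rewrite up_add, up_lt in h by auto.
    destruct (γ i0 j'); try easy; cbn in h; injection h; lia.
  + exfalso; specialize (h i0); rewrite up_add, up_lt in h by auto.
    destruct (γ i0 j); try easy; cbn in h; injection h; lia.
  + f_equal; f_equal; apply hd; try lia; intros i; specialize (h i).
    rewrite !up_add in h; exact (shift_inj h).
- exfalso; eapply hva; [exact he|exact h].
- exfalso; eapply hva; [exact he'|intros i; symmetry; exact (h i)].
- apply scoped_app in he, he'.
  pose proof (h i0) as h0; cbn in h0; injection h0 as -> -> -> _; f_equal.
  assert (h' : forall i, map (subst (up m (γ i))) ts = map (subst (up m (γ i))) ts').
  { intros i; specialize (h i); cbn in h; now injection h. }
  clear h; revert ts' he' h'; induction IH as [|t ts ht _ IHts];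
    intros [|t' ts'] he' h'; try (specialize (h' i0); discriminate h'); auto.
  inversion he; inversion he'; subst; f_equal.
  + apply ht; auto; intros i; specialize (h' i); now injection h'.
  + apply IHts; auto; intros i; specialize (h' i); now injection h'.
Qed.

Definition extends (Γ : list expr) (γ : I -> nat -> expr) (k : nat) (Γ' : list expr)
    (γ' : I -> nat -> expr) : Prop :=
  wsub Γ' (shift k) Γ /\ length Γ' = k + length Γ /\
  forall i n, γ' i (k + n) = γ i n.

Lemma extends_scomp Γ γ k Γ' γ' i : extends Γ γ k Γ' γ' ->
  scomp (shift k) (γ' i) = γ i.
Proof.
intros (_ & _ & h); apply functional_extensionality; intros n; apply h.
Qed.

Lemma scomp_assoc (r s t : nat -> expr) : scomp (scomp r s) t = scomp r (scomp s t).
Proof. apply functional_extensionality; intros n; apply subst_scomp. Qed.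

(* The last clause says that the values of the new variables can be read off the
   instances of the generic form g. *)
Definition generalizes {T : Type} (sb : (nat -> expr) -> T -> T) Γ γ (b : I -> T)
    k Γ' γ' (g : T) : Prop :=
  stage Γ' γ' /\ extends Γ γ k Γ' γ' /\
  (forall i, sb (up m (γ' i)) g = b i) /\
  (forall δ δ' : nat -> expr,
     (forall n, n < length Γ -> δ (k + n) = δ' (k + n)) ->
     sb (up m δ) g = sb (up m δ') g ->
     forall n, n < length Γ' -> δ n = δ' n).

(** The index set may be infinite, so recursion runs on the member at [i0], which bounds the
    structure common to the family. The current stage is a parameter, so that variables already
    introduced are reused. *)
Definition has_generic (b0 : expr) : Prop :=
  forall Γ γ h B (b : I -> expr), b i0 = b0 ->
  stage Γ γ -> wsub Γ h (fb F) -> wt (tel h ++ Γ) B None ->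
  (forall i, wt (tel (scomp h (γ i)) ++ Δ i) (b i) (Some (subst (up m (γ i)) B))) ->
  (forall i, skel m (b i) = skel m b0) ->
  exists k Γ' γ' g, generalizes (@subst C) Γ γ b k Γ' γ' g /\
    wt (tel (scomp h (shift k)) ++ Γ') g (Some (subst (up m (shift k)) B)).

(** The tail is treated before the head: the type of the first argument is an instance of [B] along
    the later ones, so their generic forms must be known. *)
Lemma generic_args (ts0 : list expr) : Forall has_generic ts0 ->
  forall Γ γ h W (ts : I -> list expr), ts i0 = ts0 ->
  stage Γ γ -> wsub Γ h (fb F) -> wf W -> length ts0 = length W ->
  (forall i, wsub (tel (scomp h (γ i)) ++ Δ i) (of (ts i)) W) ->
  (forall i, map (skel m) (ts i) = map (skel m) ts0) ->
  exists k Γ' γ' gs, generalizes (fun s => map (subst s)) Γ γ ts k Γ' γ' gs /\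
    length gs = length W /\
    wsub (tel (scomp h (shift k)) ++ Γ') (of gs) W.
Proof.
induction 1 as [|t0 ts0 ht0 _ IH]; intros Γ γ h W ts e0 hst hh hW el hts hsk.
- exists 0, Γ, γ, []; destruct W; [|easy]; repeat split; auto.
  + apply hst.
  + apply hst.
  + apply hst.
  + apply hst.
  + exact (@wsub_shift C [] Γ).
  + intros i; specialize (hsk i); now destruct (ts i).
  + now intros [|n].
- destruct W as [|B W]; [easy|]; apply wf_tail in hW; destruct hW as [hW hB].
  assert (e : forall i, ts i = hd bot (ts i) :: tl (ts i)).
  { intros i; specialize (hsk i); now destruct (ts i). }
  assert (hts' : forall i, wt (tel (scomp h (γ i)) ++ Δ i) (hd bot (ts i))
      (Some (subst (of (tl (ts i))) B)) /\
    wsub (tel (scomp h (γ i)) ++ Δ i) (of (tl (ts i))) W).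
  { intros i; specialize (hts i); rewrite e in hts; exact (wsub_uncons hts). }
  destruct (IH Γ γ h W (fun i => tl (ts i))) as
    (k & Γ1 & γ1 & gs & (hst1 & hex & hgs & hu) & elg & hg); auto.
  { now rewrite e0. }
  { apply hts'. }
  { intros i; specialize (hsk i); rewrite e in hsk; now injection hsk. }
  assert (ec : forall i, scomp (scomp h (shift k)) (γ1 i) = scomp h (γ i)).
  { intros i; now rewrite scomp_assoc, (extends_scomp i hex). }
  assert (hh1 : wsub Γ1 (scomp h (shift k)) (fb F)).
  { exact (wsub_comp hh (proj1 hex)). }
  destruct (ht0 Γ1 γ1 (scomp h (shift k)) (subst (of gs) B) (fun i => hd bot (ts i)))
    as (k2 & Γ2 & γ2 & g & (hst2 & hex2 & hg2 & hu2) & hg2'); auto.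
  { now rewrite e0. }
  { exact (wt_subst hB hg). }
  { intros i; rewrite ec, subst_of, hgs; apply hts'. }
  { intros i; specialize (hsk i); rewrite e in hsk; now injection hsk. }
  (* The head may have added [k2] variables, past which the forms of the tail are weakened. *)
  exists (k2 + k), Γ2, γ2, (g :: map (subst (up m (shift k2))) gs).
  assert (ek : scomp (shift k) (shift k2) = shift (C := C) (k2 + k)).
  { apply functional_extensionality; intros n; unfold scomp; cbn; unfold shift.
    f_equal; lia. }
  assert (es : forall δ : nat -> expr, map (subst (up m δ)) (map (subst (up m (shift k2))) gs)
    = map (subst (up m (scomp (shift k2) δ))) gs).
  { intros δ; rewrite map_map; apply map_ext; intros; apply subst_up_up. }
  repeat split.
  + apply hst2.
  + apply hst2.
  + apply hst2.
  + apply hst2.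
  + rewrite <- ek; apply (wsub_comp (proj1 hex)), hex2.
  + destruct hex2 as (_ & -> & _), hex as (_ & -> & _); lia.
  + intros i n; rewrite <- Nat.add_assoc.
    destruct hex as (_ & _ & h1), hex2 as (_ & _ & h2); now rewrite h2, h1.
  + intros i; cbn; rewrite es, (extends_scomp i hex2), hgs, hg2; now rewrite <- e.
  (* The tail, seen through this weakening, determines the [k] variables added for it; the head
     determines the remaining [k2]. *)
  + intros δ δ' h1 h2; cbn in h2; rewrite !es in h2; injection h2 as h2 h3.
    apply (hu2 δ δ'); auto.
    intros n hn; apply (hu _ _) with (2 := h3); auto.
    intros j hj; unfold scomp; cbn; rewrite !Nat.add_assoc; auto.
  + cbn; rewrite length_map; auto.
  + rewrite <- ek, <- scomp_assoc; apply wsub_cons.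
    * now rewrite <- subst_of.
    * intros n A hn; rewrite of_map, <- subst_of.
      apply (wt_subst (hg n A hn)), (ftel_up hh1), hex2.
Qed.

Definition args (e : expr) : list expr :=
  match e with app _ _ _ ts => ts | _ => [] end.

(** Covers types and terms alike. The type of [g] is left as computed from [k]; matching it with a
    prescribed type is a separate appeal to faithfulness. *)
Lemma generic_same_head (b0 : expr) : Forall has_generic (args b0) ->
  forall Γ γ h (b : I -> expr) W k c (o : I -> option expr), b i0 = b0 ->
  stage Γ γ -> wsub Γ h (fb F) -> (forall i, b i = app W k c (args (b i))) ->
  (forall i, wt (tel (scomp h (γ i)) ++ Δ i) (b i) (o i)) ->
  (forall i, map (skel m) (args (b i)) = map (skel m) (args b0)) ->
  exists j Γ' γ' g, generalizes (@subst C) Γ γ b j Γ' γ' g /\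
    exists gs, g = app W k c gs /\
    wt (tel (scomp h (shift j)) ++ Γ') g (option_map (subst (of gs)) k).
Proof.
intros IH Γ γ h b W k c o e0 hst hh hb hwt hsk.
assert (hi : forall i, wfc W (sρ c) /\ (forall B, k = Some B -> wt W B None) /\
  ok k c /\ length (args (b i)) = length W /\
  wsub (tel (scomp h (γ i)) ++ Δ i) (of (args (b i))) W).
{ intros i; specialize (hwt i); rewrite hb in hwt; apply wt_inv in hwt; tauto. }
destruct (@generic_args (args b0) IH Γ γ h W (fun i => args (b i))) as
  (j & Γ' & γ' & gs & (hst' & hex & hgs & hu) & elg & hg); auto.
{ now rewrite e0. }
{ exists (sX c), (sρ c); apply (hi i0). }
{ rewrite <- e0; apply hi. }
{ apply hi. }
exists j, Γ', γ', (app W k c gs); split; [split; [auto|split; [auto|split] ]|].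
- intros i; cbn; now rewrite hgs, <- hb.
- intros δ δ' h1 h2; cbn in h2; injection h2 as h2; eauto.
- exists gs; split; auto.
  destruct (hi i0) as (h1 & h2 & h3 & _); now constructor.
Qed.

Lemma fsec_up h s (e : expr) :
  subst (sec (scomp h s)) (subst (up m s) e) = subst s (subst (sec h) e).
Proof.
rewrite !subst_subst; apply subst_ext; intros n.
destruct (lt_or_add m n) as [hn|[j ->] ].
- rewrite up_lt by auto; cbn; now apply fsec_scomp.
- rewrite up_add, fsec_add, subst_subst; cbn.
  transitivity (subst var (s j)); [|apply subst_var].
  apply subst_ext; intros l; apply fsec_add.
Qed.

Lemma wt_ftel h Γ (e : expr) o : wt Γ e o ->
  wt (tel h ++ Γ) (subst (shift m) e) (option_map (subst (shift m)) o).
Proof. intros he; rewrite <- (ftel_length F h); now apply wt_weaken. Qed.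

Lemma scoped_ftel Γ h (e : expr) o :
  wt (tel h ++ Γ) e o -> scoped (m + length Γ) e.
Proof.
intros he; apply wt_scoped in he.
now rewrite length_app, ftel_length in he.
Qed.

Lemma typed_stage_faithful Γ γ h (e e' : expr) o o' :
  stage Γ γ -> wt (tel h ++ Γ) e o -> wt (tel h ++ Γ) e' o' ->
  (forall i, subst (up m (γ i)) e = subst (up m (γ i)) e') -> e = e'.
Proof.
intros hst he he'; apply (stage_faithful hst); eapply scoped_ftel; eauto.
Qed.

Lemma wt_type_wf Γ (e A : expr) : wf Γ -> wt Γ e (Some A) -> wt Γ A None.
Proof. intros (X & ρ & h); exact (wt_type h). Qed.

(** The stage stays as it is. The type of the variable is [B] because the two agree at every
    instance, by uniqueness of types. *)
Lemma variable_generalizes Γ γ h B (b : I -> expr) n :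
  stage Γ γ -> wsub Γ h (fb F) -> wt (tel h ++ Γ) B None ->
  (forall i, wt (tel (scomp h (γ i)) ++ Δ i) (b i) (Some (subst (up m (γ i)) B))) ->
  n < m + length Γ -> (forall i, up m (γ i) n = b i) ->
  exists k Γ' γ' g, generalizes (@subst C) Γ γ b k Γ' γ' g /\
    wt (tel (scomp h (shift k)) ++ Γ') g (Some (subst (up m (shift k)) B)).
Proof.
intros hst hh hB hwt hn hb.
exists 0, Γ, γ, (var n); split; [split; [auto|split; [split; [|now split]|now split] ]|].
- exact (@wsub_shift C [] Γ).
- change (shift (C := C) 0) with (var (C := C)).
  replace (scomp h var) with h
    by (apply functional_extensionality; intros; symmetry; apply subst_var).
  rewrite up_var, subst_var.
  destruct (nth_error (tel h ++ Γ) n) as [A|] eqn:e.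
  2:{ apply nth_error_None in e; rewrite length_app, ftel_length in e; lia. }
  pose proof (wt_var e) as hA.
  replace (Some B) with (Some (subst (shift (S n)) A)); auto.
  f_equal; apply (typed_stage_faithful hst (wt_type_wf (ftel_wf (proj1 hst) hh) hA) hB).
  intros i.
  pose proof (ftel_up hh (proj1 (proj2 hst) i) e) as hA'.
  rewrite hb in hA'; pose proof (wt_unique hA' (hwt i)); congruence.
Qed.

(* A family with a common head is generalized argumentwise; a family of variables
   bound by the telescope is kept; any other family avoids these variables and
   becomes a variable of the context, a new one unless it is already present. *)
Lemma generic_step (b0 : expr) : Forall has_generic (args b0) -> has_generic b0.
Proof.
intros IH Γ γ h B b e0 hst hh hB hwt hsk.
(* The index set is arbitrary, so the case split is classical. *)
destruct (classic (same_head b)) as [(W & k & c & hb)|hnh].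
{ assert (hb' : forall i, b i = app W k c (args (b i))).
  { intros i; destruct (hb i) as [ts e]; now rewrite e. }
  assert (hi : forall i, length (args (b i)) = length W /\
    Some (subst (up m (γ i)) B) = option_map (subst (of (args (b i)))) k).
  { intros i; pose proof (hwt i) as hi; rewrite hb' in hi; apply wt_inv in hi; tauto. }
  destruct (generic_same_head IH (k := k) (c := c) (W := W) (Γ := Γ) (h := h) e0 hst hh hb' hwt)
    as (j & Γ' & γ' & g & (hst' & hex & hg & hu) & gs & eg & hwg).
  { intros i; apply (@same_skel_args C m W k c).
    - rewrite <- e0; transitivity (length W); [|symmetry]; apply hi.
    - specialize (hsk i); now rewrite <- hb', hsk, <- e0, <- hb'. }
  exists j, Γ', γ', g; split; [now repeat (split; auto)|].
  destruct k as [Bf|]; [|destruct (hi i0) as [_ hf]; discriminate hf].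
  cbn in hwg; replace (subst (up m (shift j)) B) with (subst (of gs) Bf); auto.
  assert (hh' : wsub Γ' (scomp h (shift j)) (fb F)) by exact (wsub_comp hh (proj1 hex)).
  apply (typed_stage_faithful hst' (wt_type_wf (ftel_wf (proj1 hst') hh') hwg)
    (wt_subst hB (ftel_up hh (proj1 hex)))).
  intros i; specialize (hg i); rewrite eg, hb' in hg; cbn in hg; injection hg as hg.
  rewrite subst_of, hg, subst_up_up, (extends_scomp i hex).
  destruct (hi i) as [_ hf]; cbn in hf; congruence. }
destruct (classic (exists n, n < m /\ b0 = var n)) as [(n & hn & ->)|hv].
{ apply (variable_generalizes hst hh hB hwt (n := n)); [lia|].
  intros i; specialize (hsk i); rewrite skel_lt in hsk by auto.
  rewrite up_lt by auto.
  destruct (b i) as [n'| |W k c ts]; try easy.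
  - destruct (lt_or_add m n') as [h'|[j ->] ].
    + now rewrite skel_lt in hsk.
    + now rewrite skel_add in hsk.
  - destruct (skel_app m W k c ts) as [ [e _]|e]; congruence. }
(* Otherwise the skeleton of [b0] would keep its head, and by [hsk] every member would have that
   head, against [hnh]. *)
assert (hs0 : skel m b0 = bot).
{ destruct b0 as [n| |W k c ts]; auto.
  - destruct (lt_or_add m n) as [h'|[j ->] ].
    + exfalso; eauto.
    + apply skel_add.
  - destruct (skel_app m W k c ts) as [ [e _]|e]; auto.
    exfalso; apply hnh; exists W, k, c; intros i; specialize (hsk i); rewrite e in hsk.
    destruct (b i) as [n'| |W' k' c' ts']; try easy.
    + destruct (lt_or_add m n') as [h'|[j ->] ].
      * now rewrite skel_lt in hsk.
      * now rewrite skel_add in hsk.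
    + destruct (skel_app m W' k' c' ts') as [ [e' _]|e']; [congruence|].
      rewrite e' in hsk; injection hsk as -> -> -> _; eauto. }
(* The section moves each member down to its context; [eb] recovers the member by weakening. *)
set (b' := fun i => subst (sec (scomp h (γ i))) (b i)).
assert (eb : forall i, subst (shift m) (b' i) = b i).
{ intros i; eapply skel_bot; [now rewrite hsk| |intros; apply fsec_add].
  exact (wt_scoped (hwt i)). }
set (B' := subst (sec h) B).
assert (hB' : wt Γ B' None) by exact (wt_subst hB (fsec_wsub hh)).
assert (hb' : forall i, wt (Δ i) (b' i) (Some (subst (γ i) B'))).
{ intros i; unfold B'; rewrite <- fsec_up.
  exact (wt_subst (hwt i) (fsec_wsub (wsub_comp hh (proj1 (proj2 hst) i)))). }
(* The prescribed type avoids the bound variables as well, since all its instances do; so [B'] can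
   type a context variable. *)
assert (eB : B = subst (shift m) B').
{ apply (typed_stage_faithful hst hB (wt_ftel h hB')).
  intros i; rewrite subst_up_shift.
  pose proof (wt_ftel (scomp h (γ i)) (hb' i)) as hi; rewrite eb in hi.
  pose proof (wt_unique hi (hwt i)) as e; cbn in e; congruence. }
(* Adding a second variable with the same values would violate the distinctness clause of
   [stage]. *)
destruct (classic (exists n, n < length Γ /\ forall i, γ i n = b' i)) as [(n & hn & hi)|hnew].
{ apply (variable_generalizes hst hh hB hwt (n := m + n)); [lia|].
  intros i; now rewrite up_add, hi, eb. }
destruct hst as (hwf & hγ & hf & hd).
exists 1, (B' :: Γ), (fun i n => match n with 0 => b' i | S n => γ i n end), (var (m + 0)).
split; [split; [|split; [|split] ]|].
- split; [now apply wf_cons|split; [|split] ].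
  + intros i [|n] A hn; cbn in hn.
    * injection hn as <-; rewrite subst_subst; apply hb'.
    * rewrite subst_subst; cbn.
      pose proof (hγ i n A hn) as h'; rewrite subst_subst in h'; exact h'.
  + intros [|n] hn (W & k & c & hc); [|apply (hf n); [cbn in hn; lia|now exists W, k, c] ].
    apply hnh; exists W, k, c; intros i; destruct (hc i) as [ts e].
    rewrite <- eb, e; cbn; eauto.
  + intros [|n] [|n'] hn hn' h'; auto; cbn in hn, hn'.
    * exfalso; apply hnew; exists n'; split; [lia|]; intros i; symmetry; apply h'.
    * exfalso; apply hnew; exists n; split; [lia|]; exact h'.
    * f_equal; apply hd; auto; lia.
- split; [exact (@wsub_shift C [B'] Γ)|now split].
- intros i; cbn; now rewrite up_add, eb.
- intros δ δ' h1 h2 [|n] hn; [|apply h1; cbn in hn; lia].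
  cbn in h2; rewrite !up_add in h2; exact (shift_inj h2).
- pose proof (wt_ftel (scomp h (shift 1)) (wt_var (Γ := B' :: Γ) (n := 0) eq_refl)) as h'.
  cbn in h'; rewrite eB, subst_up_shift; exact h'.
Qed.

Lemma all_generic (b0 : expr) : has_generic b0.
Proof.
induction b0 as [n| |W k c ts IH] using expr_nested_ind; apply generic_step; cbn; auto.
Qed.

(** No variable can stand for a type, so a common head is assumed at the root. Skeletons are
    compared argumentwise, as that of the whole type may be [bot]. *)
Lemma generic_type Γ γ h (b : I -> expr) W k c :
  stage Γ γ -> wsub Γ h (fb F) ->
  (forall i, b i = app W k c (args (b i))) ->
  (forall i, wt (tel (scomp h (γ i)) ++ Δ i) (b i) None) ->
  (forall i, map (skel m) (args (b i)) = map (skel m) (args (b i0))) ->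
  exists j Γ' γ' g, generalizes (@subst C) Γ γ b j Γ' γ' g /\
    wt (tel (scomp h (shift j)) ++ Γ') g None.
Proof.
intros hst hh hb hwt hsk.
assert (IH : Forall has_generic (args (b i0))).
{ apply Forall_forall; intros; apply all_generic. }
destruct (generic_same_head IH (o := fun _ => None) eq_refl hst hh hb hwt hsk)
  as (j & Γ' & γ' & g & hg & gs & -> & hwg).
exists j, Γ', γ', (app W k c gs); split; auto.
specialize (hwt i0); rewrite hb in hwt; apply wt_inv in hwt.
destruct hwt as (_ & _ & _ & _ & _ & e); now destruct k.
Qed.

End Generic.

(** * Identity types in the syntax *)

Section Id.
Context (C : CwF) (IC : WeaklyStableId C).
Notation expr := (expr C).

Definition genty (W : list expr) (k : option expr) (c : sym C) : expr :=
  app W k c (ids (length W)).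

Definition ext_env {X : Ob C} (ρ : list (sem X)) (T : Ty X) : list (sem (ext T)) :=
  stm (q T) :: map (ssub (p T)) ρ.

Definition sym_refl (c : sym C) : sym C :=
  let T := projT1 (sv c) in
  Sym (ext_env (sρ c) T) (stm (wrefl IC (q T))).

Definition sym_id (c : sym C) : sym C :=
  let T := projT1 (sv c) in
  Sym (ext_env (ext_env (sρ c) T) T[[p T]]) (sty (wId IC (q T))).

(* Id(A,x,y) and refl(A,x) are instances of the identity type of the last
   variable of W.T, for A an instance of the type generator T over W. *)
Definition rId (A x y : expr) : expr :=
  match A with
  | app W k c s =>
      app (subst (shift 1) (genty W k c) :: genty W k c :: W) None (sym_id c)
        (y :: x :: s)
  | _ => bot
  end.

Definition rrefl (A x : expr) : expr :=
  match A with
  | app W k c s =>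
      app (genty W k c :: W)
        (Some (rId (subst (shift 1) (genty W k c)) (var 0) (var 0)))
        (sym_refl c) (x :: s)
  | _ => bot
  end.

Lemma rId_subst Γ A x y s : wt Γ A None ->
  subst s (rId A x y) = rId (subst s A) (subst s x) (subst s y).
Proof.
intros h; apply wt_inv in h; destruct A; auto; destruct h as (? & _ & e); discriminate e.
Qed.

Lemma rrefl_subst Γ A x s : wt Γ A None ->
  subst s (rrefl A x) = rrefl (subst s A) (subst s x).
Proof.
intros h; apply wt_inv in h; destruct A; auto; destruct h as (? & _ & e); discriminate e.
Qed.

Record type_node Γ W k c (s : list expr) : Prop := {
  tn_k : k = None;
  tn_sv : sv c = sty (projT1 (sv c));
  tn_wfc : wfc W (sρ c);
  tn_gen : wt W (genty W k c) None;
  tn_interp : interp (sρ c) (genty W k c) (sty (projT1 (sv c)));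
  tn_length : length s = length W;
  tn_wsub : wsub Γ (of s) W;
  tn_subst : subst (of s) (genty W k c) = app W k c s
}.

Lemma genty_subst s W k c :
  length s = length W -> subst (of s) (genty W k c) = app W k c s.
Proof. intros h; cbn; f_equal; now apply map_of_ids. Qed.

(** Variables are terms, so every type is an instance of a generator; this justifies the case
    analyses in [rId] and [rrefl]. *)
Lemma type_node_intro Γ (A : expr) : wt Γ A None ->
  exists W k c s, A = app W k c s /\ type_node Γ W k c s.
Proof.
intros h; apply wt_inv in h; destruct A as [n| |W k c s]; [now destruct h as (? & ? & ?)|easy|].
destruct h as (hW & _ & hc & el & hs & hk).
exists W, k, c, s; split; auto.
destruct k as [B|]; [easy|]; cbn in hc.
assert (e : sv c = sty (projT1 (sv c))).
{ destruct (sv c) as [T o]; cbn in *; now subst. }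
split; auto.
- apply (@wt_app C W W None c (ids (length W))); auto; try easy.
  + now rewrite length_ids.
  + exact (wsub_ids hW).
- apply interp_app; exists (idh _); rewrite map_ssub_id, ssub_id; split; auto.
  rewrite <- (wfc_length hW); apply ids_interp.
- now apply genty_subst.
Qed.

Lemma wfc_ext_env Γ X (ρ : list (sem X)) A (T : Ty X) :
  wfc Γ ρ -> wt Γ A None -> interp ρ A (sty T) -> wfc (A :: Γ) (ext_env ρ T).
Proof. apply wfc_cons. Qed.

Lemma interp_shift1 X (ρ : list (sem X)) (e : expr) s (T : Ty X) :
  interp ρ e s -> interp (ext_env ρ T) (subst (shift 1) e) (ssub (p T) s).
Proof. exact (@interp_shift C _ _ (p T) ρ [stm (q T)] e s). Qed.

Lemma wt_shift1 Γ B (e : expr) o : wt Γ e o ->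
  wt (B :: Γ) (subst (shift 1) e) (option_map (subst (shift 1)) o).
Proof. exact (@wt_weaken C [B] Γ e o). Qed.

Lemma wfc_id_env Γ W k c s : type_node Γ W k c s ->
  wfc (subst (shift 1) (genty W k c) :: genty W k c :: W) (sρ (sym_id c)).
Proof.
intros [hk hv hW hg hi _ _ _]; cbn.
apply wfc_ext_env.
- now apply wfc_ext_env.
- exact (wt_shift1 _ hg).
- exact (interp_shift1 _ hi).
Qed.

Lemma wt_rId Γ A x y : wt Γ A None -> wt Γ x (Some A) -> wt Γ y (Some A) ->
  wt Γ (rId A x y) None.
Proof.
intros hA hx hy; apply type_node_intro in hA.
destruct hA as (W & k & c & s & -> & hn); pose proof (wfc_id_env hn) as hE.
destruct hn as [hk hv hW hg hi el hs es]; cbn [rId].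
apply (@wt_app C Γ _ None); auto; try easy.
- cbn; auto.
- apply wsub_cons; [|apply wsub_cons; auto].
  + now rewrite subst_of_cons, es.
  + now rewrite es.
Qed.

Lemma wt_rrefl Γ A x : wt Γ A None -> wt Γ x (Some A) ->
  wt Γ (rrefl A x) (Some (rId A x x)).
Proof.
intros hA hx; apply type_node_intro in hA.
destruct hA as (W & k & c & s & -> & hn).
destruct hn as [hk hv hW hg hi el hs es].
set (A1 := subst (shift 1) (genty W k c)).
assert (hA1 : wt (genty W k c :: W) A1 None) by exact (wt_shift1 _ hg).
assert (hv0 : wt (genty W k c :: W) (var 0) (Some A1)) by now apply wt_var.
assert (hB : wt (genty W k c :: W) (rId A1 (var 0) (var 0)) None) by now apply wt_rId.
replace (Some (rId (app W k c s) x x)) with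
  (option_map (subst (of (x :: s))) (Some (rId A1 (var 0) (var 0)))).
2:{ cbn [option_map]; f_equal; rewrite (rId_subst _ _ _ hA1).
    unfold A1; now rewrite subst_of_cons, es. }
apply wt_app; auto.
- now apply wfc_ext_env.
- now intros B [= <-].
- eexists _, _; split; [reflexivity|].
  set (T := projT1 (sv c)).
  (* The diagonal from W.T to W.T.T, along which the generic identity type becomes the type of
     [wrefl]. *)
  apply interp_app; exists (inst (q T)); split; [|reflexivity].
  cbn [sym_id sρ ext_env map].
  assert (ep : forall s, ssub (inst (q T)) (ssub (p T[[p T]]) s) = s).
  { intros x0; now rewrite <- ssub_comp, p_inst, ssub_id. }
  fold T; rewrite ep.
  rewrite map_map, (map_ext _ _ ep), map_id.
  constructor; [|constructor; [reflexivity|] ].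
  + cbn; f_equal; symmetry; apply stm_eq, q_inst.
  + unfold ids; rewrite map_map.
    rewrite <- (wfc_length hW).
    pose proof (ids_interp (ext_env (sρ c) T)) as hids.
    inversion hids as [|? ? ? ? _ h2]; subst.
    rewrite length_map in h2.
    replace (map _ (seq 0 (length (sρ c)))) with (map (@var C) (seq 1 (length (sρ c)))); auto.
    rewrite <- seq_shift, map_map; reflexivity.
- cbn; auto.
- apply wsub_cons; auto; now rewrite es.
Qed.

Definition idfam (A x : expr) : expr :=
  rId (subst (shift 1) A) (subst (shift 1) x) (var 0).

Definition idtel (A x : expr) : list expr := [idfam A x; A].

(** The substitution ⟨id, x, refl⟩. *)
Definition idsec (A x : expr) (n : nat) : expr :=
  match n with 0 => rrefl A x | 1 => x | S (S n) => var n end.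

Lemma up_succ n s : up (C := C) (S n) s = up 1 (up n s).
Proof.
apply functional_extensionality; intros j.
destruct j as [|j]; auto.
change (S j) with (1 + j) at 2; rewrite up_add.
destruct (lt_or_add n j) as [h|[i ->] ].
- now rewrite !up_lt by lia.
- change (S (n + i)) with (S n + i); rewrite !up_add.
  now rewrite subst_shift_shift.
Qed.

Lemma wsub_up1 Γ Δ A (s : nat -> expr) :
  wsub Δ s Γ -> wsub (subst s A :: Δ) (up 1 s) (A :: Γ).
Proof.
intros h [|n] B hn; cbn in hn.
- injection hn as <-; rewrite subst_up_shift; now apply wt_var.
- change (S (S n)) with (1 + S n); change (S n) with (1 + n) at 1.
  rewrite up_add, <- subst_shift_shift, subst_up_shift.
  exact (wt_shift1 _ (h n B hn)).
Qed.

Lemma wt_idfam Γ A x : wt Γ A None -> wt Γ x (Some A) ->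
  wt (A :: Γ) (idfam A x) None.
Proof.
intros hA hx; apply wt_rId.
- exact (wt_shift1 _ hA).
- exact (wt_shift1 _ hx).
- now apply wt_var.
Qed.

Lemma idfam_up Γ A x s : wt Γ A None ->
  subst (up 1 s) (idfam A x) = idfam (subst s A) (subst s x).
Proof.
intros hA; unfold idfam.
now rewrite (rId_subst _ _ _ (wt_shift1 A hA)), !subst_up_shift.
Qed.

Lemma idtel_up Γ Δ A x s : wt Γ A None -> wsub Δ s Γ ->
  wsub (idtel (subst s A) (subst s x) ++ Δ) (up 2 s) (idtel A x ++ Γ).
Proof.
intros hA hs; cbn; rewrite up_succ, <- (idfam_up x s hA).
now apply wsub_up1, wsub_up1.
Qed.

Lemma wf_idtel Γ A x : wf Γ -> wt Γ A None -> wt Γ x (Some A) -> wf (idtel A x ++ Γ).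
Proof.
intros h hA hx; cbn; apply wf_cons; [now apply wf_cons|now apply wt_idfam].
Qed.

Lemma idsec_wsub Γ A x : wt Γ A None -> wt Γ x (Some A) ->
  wsub Γ (idsec A x) (idtel A x ++ Γ).
Proof.
intros hA hx [|[|n] ] B hn; cbn in hn.
- injection hn as <-; rewrite subst_subst; unfold idfam.
  pose proof (wt_rrefl hA hx) as h.
  rewrite (rId_subst _ _ _ (wt_shift1 A hA)), !subst_subst; cbn.
  rewrite !(subst_ext (s := fun n => var n) (s' := var)), !subst_var by auto.
  exact h.
- injection hn as <-; rewrite subst_subst; cbn.
  now rewrite (subst_ext (s := fun n => var n) (s' := var)), subst_var by auto.
- rewrite subst_subst; cbn; now apply wt_var.
Qed.

Lemma idsec_scomp Γ A x s n : wt Γ A None -> n < 2 ->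
  idsec (subst s A) (subst s x) n = subst s (idsec A x n).
Proof.
intros hA hn; destruct n as [|[|n] ]; cbn; auto; [|lia].
symmetry; exact (rrefl_subst _ _ hA).
Qed.

Lemma idsec_up Γ A x s e : wt Γ A None ->
  subst (idsec (subst s A) (subst s x)) (subst (up 2 s) e) = subst s (subst (idsec A x) e).
Proof.
intros hA; rewrite !subst_subst; apply subst_ext; intros n.
destruct (lt_or_add 2 n) as [hn|[j ->] ].
- rewrite up_lt by auto; exact (idsec_scomp _ _ hA hn).
- rewrite up_add, subst_subst; cbn.
  now rewrite (subst_ext (s := fun n => var n) (s' := var)), subst_var by auto.
Qed.

(** [U] is the generic identity type substituted along a map with components [a] and [b], so
    [path_instance] applies. *)
Lemma interp_rId Γ X (ρ : list (sem X)) A x y (T : Ty X) (a b : Tm T) (U : Ty X) :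
  wt Γ x (Some A) -> wt Γ y (Some A) -> wt Γ A None ->
  interp ρ x (stm a) -> interp ρ y (stm b) -> interp ρ (rId A x y) (sty U) ->
  inhabited (Tm U) <-> path IC a b.
Proof.
intros hx hy hA ha hb hU; apply type_node_intro in hA.
destruct hA as (W & k & c & s & -> & hn).
cbn [rId] in hU; apply interp_app in hU; destruct hU as (τ & hτ & eU).
cbn [sym_id sρ sv ext_env map] in hτ, eU.
inversion hτ as [|? ? ? ? h1 h2]; subst.
inversion h2 as [|? ? ? ? h3 h4]; subst.
apply sty_inj in eU; subst U.
pose proof (interp_fun hx ha h3) as e3; rewrite <- ssub_comp in e3.
pose proof (interp_fun hy hb h1) as e1.
apply path_instance.
- apply (proj2 (stm_eq _ _)); exact e3.
- apply (proj2 (stm_eq _ _)); exact e1.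
Qed.

Lemma interp_list_fun Γ X (ρ : list (sem X)) (ts : list expr) l l' :
  Forall (fun t => exists B, wt Γ t (Some B)) ts ->
  Forall2 (interp ρ) ts l -> Forall2 (interp ρ) ts l' -> l = l'.
Proof.
intros h; revert l l'; induction h as [|t ts [B ht] _ IH]; intros l l' h h';
  inversion h; inversion h'; subst; auto.
f_equal; auto; eapply interp_fun; eauto.
Qed.

Lemma interp_list_shift1 X (ρ : list (sem X)) (ts : list expr) l (T : Ty X) :
  Forall2 (interp ρ) ts l ->
  Forall2 (interp (ext_env ρ T)) (map (subst (shift 1)) ts) (map (ssub (p T)) l).
Proof.
induction 1; cbn [map]; constructor; auto; now apply interp_shift1.
Qed.

(** The reflexivity is interpreted along some [γ] and the family along some [τ], obtained
    independently; [instance_is_id_family] applies once [τ] is shown to lie over [γ]. *)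
Lemma rrefl_is_id_family Γ X (ρ : list (sem X)) A x (T : Ty X) (a : Tm T)
    (U : Ty (ext T)) (V : Ty X) (r : Tm V) (r' : Tm U[[inst a]]) :
  wfc Γ ρ -> wt Γ A None -> wt Γ x (Some A) ->
  interp ρ A (sty T) -> interp ρ x (stm a) ->
  interp (ext_env ρ T) (idfam A x) (sty U) ->
  interp ρ (rrefl A x) (stm r) -> r' ≡ r ->
  is_id_family IC r'.
Proof.
intros hΓ hA hx hT ha hU hr er.
pose proof (wt_idfam hA hx) as hid.
pose proof (type_node_intro hA) as (W & k & c & s & eA & hn).
rewrite eA in hU, hr.
cbn [rrefl] in hr; apply interp_app in hr; destruct hr as (γ & hγ & eγ).
cbn [sym_refl sρ sv] in hγ, eγ; unfold ext_env in hγ; cbn [map] in hγ.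
set (T0 := projT1 (sv c)) in *.
inversion hγ as [|? ? ? ? h1 h2]; subst.
unfold idfam in hU; cbn [rId subst] in hU; apply interp_app in hU.
destruct hU as (τ & hτ & eU).
cbn [sym_id sρ sv] in hτ, eU; unfold ext_env at 2 3 in hτ; cbn [map] in hτ.
fold T0 in hτ, eU, τ.
inversion hτ as [|? ? ? ? h3 h4]; subst.
inversion h4 as [|? ? ? ? h5 h6]; subst.
apply sty_inj in eU; subst U.
pose proof (interp_fun hx ha h1) as e1.
assert (e5 : ssub (p T) (stm a) = ssub τ (ssub (p T0[[p T0]]) (stm (q T0)))).
{ refine (interp_fun (wt_shift1 x hx) _ h5); exact (interp_shift1 T ha). }
assert (e3 : stm (q T) = ssub τ (stm (q T0[[p T0]]))).
{ exact (f_equal (fun o => match o with Some z => z | None => stm (q T) end) h3). }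
apply (@instance_is_id_family C IC X _ _ (q T0) γ T a τ _ r'); auto.
- apply (proj2 (stm_eq _ _)); exact e1.
- apply pair_uniq.
  (* It suffices to compare on the variables of [W], where both maps interpret the weakened
     arguments [s]. *)
  + rewrite <- !comp_assoc; apply (wfc_mono (tn_wfc hn)).
    rewrite !map_ssub_comp.
    apply (@interp_list_fun (x :: Γ) _ (ext_env ρ T) (map (subst (shift 1)) s)).
    * apply Forall_map.
      pose proof (wsub_args (tn_length hn) (tn_wsub hn)) as hs'.
      revert hs'; apply Forall_impl; intros t [B hB].
      eexists; exact (wt_shift1 _ hB).
    * exact h6.
    * exact (interp_list_shift1 T h2).
  + apply (proj2 (stm_eq _ _)).
    change (ssub (p T0[[p T0]] ∘ τ) (stm (q T0)) = ssub (γ ∘ p T) (stm (q T0))).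
    rewrite !ssub_comp; transitivity (ssub (p T) (stm a)); [now symmetry|].
    exact (f_equal (ssub (p T)) e1).
- apply (proj2 (stm_eq _ _)); symmetry; exact e3.
- apply (oeq_trans er), (proj2 (stm_eq _ _)); exact eγ.
Qed.

(** The generator with value [T], applied to all variables. Boxing gives the chosen lifts of the
    trivial fibration and turns inhabitants found in [C] into syntax. *)
Definition boxed_type {X : Ob C} (Γ : list expr) (ρ : list (sem X)) (T : Ty X) : expr :=
  app Γ None (Sym ρ (sty T)) (ids (length Γ)).

Definition boxed_term {X : Ob C} (Γ : list expr) (ρ : list (sem X)) (B : expr)
    {T : Ty X} (a : Tm T) : expr :=
  app Γ (Some B) (Sym ρ (stm a)) (ids (length Γ)).

Lemma interp_ids Γ X (ρ : list (sem X)) (W : list expr) k (s : sem X) :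
  wfc Γ ρ -> interp ρ (app W k (Sym ρ s) (ids (length Γ))) s.
Proof.
intros h; apply interp_app; exists (idh X); cbn [sρ sv].
rewrite map_ssub_id, ssub_id, <- (wfc_length h); split; auto; apply ids_interp.
Qed.

Lemma wt_boxed_type Γ X (ρ : list (sem X)) (T : Ty X) :
  wfc Γ ρ -> wt Γ (boxed_type Γ ρ T) None.
Proof.
intros h; apply (@wt_app C Γ Γ None); auto; try easy.
- now rewrite length_ids.
- exact (wsub_ids h).
Qed.

Lemma wt_boxed_term Γ X (ρ : list (sem X)) B (T : Ty X) (a : Tm T) :
  wfc Γ ρ -> wt Γ B None -> interp ρ B (sty T) ->
  wt Γ (boxed_term Γ ρ B a) (Some B).
Proof.
intros h hB hT.
replace (Some B) with (option_map (subst (of (ids (length Γ)))) (Some B))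
  by (cbn; now rewrite (subst_ids (wt_scoped hB))).
apply wt_app; auto.
- now intros B' [= <-].
- now exists T, a.
- now rewrite length_ids.
- exact (wsub_ids h).
Qed.

Lemma idsec_of (Γ : list expr) A x n : n < 2 + length Γ ->
  of (rrefl A x :: x :: ids (length Γ)) n = idsec A x n.
Proof.
intros hn; destruct n as [|[|n] ]; auto.
cbn; apply of_ids; lia.
Qed.

Lemma inst_env Γ X (ρ : list (sem X)) (x : expr) (T : Ty X) (a : Tm T) :
  wfc Γ ρ -> interp ρ x (stm a) ->
  Forall2 (interp ρ) (x :: ids (length Γ)) (map (ssub (inst a)) (ext_env ρ T)).
Proof.
intros hΓ ha; unfold ext_env; cbn [map]; constructor.
- replace (ssub (inst a) (stm (q T))) with (stm a); auto.
  apply (proj1 (stm_eq _ _)), oeq_sym, q_inst.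
- rewrite <- map_ssub_comp, p_inst, map_ssub_id, <- (wfc_length hΓ).
  apply ids_interp.
Qed.

Lemma interp_idfam_inst Γ X (ρ : list (sem X)) A x (T : Ty X) (a : Tm T)
    (U : Ty (ext T)) :
  wfc Γ ρ -> wt Γ A None -> wt Γ x (Some A) -> interp ρ x (stm a) ->
  interp (ext_env ρ T) (idfam A x) (sty U) ->
  interp ρ (rId A x x) (sty U[[inst a]]).
Proof.
intros hΓ hA hx ha hU.
replace (rId A x x) with (subst (of (x :: ids (length Γ))) (idfam A x)).
- exact (interp_subst_of hU (inst_env hΓ ha)).
- unfold idfam; rewrite (rId_subst _ _ _ (wt_shift1 A hA)), !subst_of_cons.
  rewrite (subst_ids (wt_scoped hA)), (subst_ids (wt_scoped hx)); reflexivity.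
Qed.

(** The data are interpreted in [C], solved there by the lifting property of the identity family,
    and the solutions are boxed. Stability is not yet at issue. *)
Lemma J_exists Γ A x P d : wf Γ -> wt Γ A None -> wt Γ x (Some A) ->
  wt (idtel A x ++ Γ) P None -> wt Γ d (Some (subst (idsec A x) P)) ->
  exists j jβ, wt (idtel A x ++ Γ) j (Some P) /\
    wt Γ jβ (Some (rId (subst (idsec A x) P) (subst (idsec A x) j) d)).
Proof.
intros (X & ρ & hΓ) hA hx hP hd.
destruct (sound_ty hΓ hA) as [T hT].
destruct (sound_tm hΓ hT hx) as [a ha].
pose proof (wfc_ext_env hΓ hA hT) as hΓ1.
pose proof (wt_idfam hA hx) as hid.
destruct (sound_ty hΓ1 hid) as [U hU].
pose proof (wfc_ext_env hΓ1 hid hU) as hΓ2.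
destruct (sound_ty hΓ2 hP) as [TP hTP].
pose proof (wt_rrefl hA hx) as hr.
pose proof (interp_idfam_inst hΓ hA hx ha hU) as hV.
destruct (sound_tm hΓ hV hr) as [r hr'].
destruct (pointed_hom r) as (ρr & pr & qr).
assert (hsec : Forall2 (interp ρ) (rrefl A x :: x :: ids (length Γ))
  (map (ssub ρr) (ext_env (ext_env ρ T) U))).
{ unfold ext_env at 1; cbn [map]; constructor.
  - replace (ssub ρr (stm (q U))) with (stm r); auto.
    apply (proj1 (stm_eq _ _)), oeq_sym, qr.
  - rewrite <- map_ssub_comp, pr; exact (inst_env hΓ ha). }
assert (esec : forall e o, wt (idtel A x ++ Γ) e o ->
  subst (of (rrefl A x :: x :: ids (length Γ))) e = subst (idsec A x) e).
{ intros e o he; apply wt_scoped in he; apply subst_scoped with (1 := he).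
  intros n hn; now apply idsec_of. }
pose proof (interp_subst_of hTP hsec) as hP'; rewrite (esec _ _ hP) in hP'.
destruct (sound_tm hΓ hP' hd) as [dd hdd].
pose proof (rrefl_is_id_family hΓ hA hx hT ha hU hr' eq_refl) as hfam.
destruct (hfam ρr pr qr TP dd) as [j hj].
set (je := boxed_term (idtel A x ++ Γ) (ext_env (ext_env ρ T) U) P j).
assert (hje : wt (idtel A x ++ Γ) je (Some P)) by now apply wt_boxed_term.
pose proof (interp_ids (idtel A x ++ Γ) (Some P) (stm j) hΓ2) as hji.
change (interp (ext_env (ext_env ρ T) U) je (stm j)) in hji.
pose proof (interp_subst_of hji hsec) as hj'; rewrite (esec _ _ hje) in hj'.
pose proof (wt_subst hP (idsec_wsub hA hx)) as hwP.
pose proof (wt_subst hje (idsec_wsub hA hx)) as hwj.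
pose proof (wt_rId hwP hwj hd) as hI.
destruct (sound_ty hΓ hI) as [V hVi].
destruct (interp_rId hwj hd hwP hj' hdd hVi) as [_ h].
(* The weak rule gives a path from [d] to [J], the stable one asks for a path from [J] to [d]. *)
destruct (h (path_sym hj)) as [u].
exists je, (boxed_term Γ ρ (rId (subst (idsec A x) P) (subst (idsec A x) je) d) u).
split; auto; now apply wt_boxed_term.
Qed.

(** * Generic elimination data and the stable choice of [J] *)

Lemma up0 (s : nat -> expr) : up 0 s = s.
Proof.
apply functional_extensionality; intros n; change n with (0 + n) at 1.
rewrite up_add; exact (subst_var (s n)).
Qed.

Lemma skel0 (e : expr) : skel 0 e = bot.
Proof. rewrite <- (subst_var e); exact (skel_shift 0 e). Qed.

(** The frame for [A], [x] and [d], which bind no variables. *)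
Definition empty_frame : frame C.
Proof.
refine (@Build_frame C [] 0 (fun _ => []) (fun _ => var) _ _ _ _ _ _); auto.
- intros; now rewrite up0.
- intros; exact (@wsub_shift C [] Γ).
- intros; lia.
Defined.

(** The frame for the motive: its telescope is pulled back from the [A] and [x] over the base
    [Γ]. *)
Definition id_frame (Γ : list expr) A x (hA : wt Γ A None) (hx : wt Γ x (Some A)) : frame C.
Proof.
refine (@Build_frame C Γ 2 (fun h => idtel (subst h A) (subst h x))
  (fun h => idsec (subst h A) (subst h x)) _ _ _ _ _ _); auto.
- intros Δ h hΔ hh; exact (wf_idtel hΔ (wt_subst hA hh) (wt_subst hx hh)).
- intros Δ Θ h s hh hs; rewrite <- !subst_scomp.
  exact (idtel_up (x := subst h x) (wt_subst hA hh) hs).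
- intros Δ h hh; exact (idsec_wsub (wt_subst hA hh) (wt_subst hx hh)).
- intros h s n hn; rewrite <- !subst_scomp.
  destruct n as [|[|n] ]; cbn; auto; [|lia].
  pose proof (type_node_intro hA) as (W & k & c & t & -> & _); reflexivity.
Defined.

Record elim := Elim { eΓ : list expr; eA : expr; ea : expr; eP : expr; ed : expr }.

Record valid (e : elim) : Prop := {
  v_wf : wf (eΓ e);
  v_A : wt (eΓ e) (eA e) None;
  v_a : wt (eΓ e) (ea e) (Some (eA e));
  v_P : wt (idtel (eA e) (ea e) ++ eΓ e) (eP e) None;
  v_d : wt (eΓ e) (ed e) (Some (subst (idsec (eA e) (ea e)) (eP e)))
}.

Definition elim_subst (γ : nat -> expr) (g : elim) (Δ : list expr) : elim :=
  Elim Δ (subst γ (eA g)) (subst γ (ea g)) (subst (up 2 γ) (eP g))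
    (subst γ (ed g)).

(** Keeps the head even when the type avoids the bound variables, since a type cannot be generalized
    to a variable. *)
Definition skel_type (m : nat) (e : expr) : expr :=
  match e with
  | app W k c ts => app W k c (map (skel m) ts)
  | e => e
  end.

(** With no bound variables all arguments of [A] collapse, leaving its head and arity. The terms [x]
    and [d] do not enter: every family of them has a generic form. *)
Definition key (e : elim) : expr * expr := (skel_type 0 (eA e), skel_type 2 (eP e)).

Lemma skel_type_up m s Γ (e : expr) : wt Γ e None ->
  skel_type m (subst (up m s) e) = skel_type m e.
Proof.
intros h; apply type_node_intro in h; destruct h as (W & k & c & ts & -> & _).
cbn; f_equal; rewrite map_map; apply map_ext; intros; apply skel_up.
Qed.

Lemma skel_type_eq m (e e' : expr) Γ : wt Γ e None -> skel_type m e' = skel_type m e ->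
  exists W k c, e = app W k c (args e) /\ e' = app W k c (args e') /\
    map (skel m) (args e') = map (skel m) (args e).
Proof.
intros h e0; apply type_node_intro in h; destruct h as (W & k & c & ts & -> & _).
destruct e'; try easy; cbn in e0; injection e0 as -> -> -> e0.
now exists W, k, c.
Qed.

(** Anti-unifies the class of [κ] in the order [A], [x], [P], [d], each over the stage produced by
    the previous ones, which supplies its type or its frame. *)
Lemma generic_elim (κ : expr * expr) : (exists e, valid e /\ key e = κ) ->
  exists g, valid g /\
  (forall e, valid e -> key e = κ ->
     exists γ, wsub (eΓ e) γ (eΓ g) /\ elim_subst γ g (eΓ e) = e) /\
  (forall γ γ' Δ, elim_subst γ g Δ = elim_subst γ' g Δ ->
     forall n, n < length (eΓ g) -> γ n = γ' n).
Proof.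
intros (e0 & he0 & hκ).
pose (I := {e | valid e /\ key e = κ}).
pose (i0 := exist (fun e => valid e /\ key e = κ) e0 (conj he0 hκ) : I).
pose (E := fun i : I => proj1_sig i).
assert (hv : forall i, valid (E i)) by exact (fun i => proj1 (proj2_sig i)).
assert (hk : forall i, key (E i) = key (E i0)).
{ intros i; transitivity κ; [exact (proj2 (proj2_sig i))|now symmetry]. }
set (F0 := empty_frame).
(* The initial context is empty, so the values are a mere default. *)
pose (γ0 := fun (_ : I) (_ : nat) => @bot C).
assert (hst0 : stage (fun i => eΓ (E i)) [] γ0).
{ split; [exists emp, []; constructor|split; [now intros i [|n]|split] ]; intros n; cbn; lia. }
assert (hA : forall i, exists W k c, eA (E i0) = app W k c (args (eA (E i0))) /\
  eA (E i) = app W k c (args (eA (E i))) /\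
  map (skel 0) (args (eA (E i))) = map (skel 0) (args (eA (E i0)))).
{ intros i; apply (skel_type_eq (v_A (hv i0))); specialize (hk i).
  exact (f_equal fst hk). }
assert (hP : forall i, exists W k c, eP (E i0) = app W k c (args (eP (E i0))) /\
  eP (E i) = app W k c (args (eP (E i))) /\
  map (skel 2) (args (eP (E i))) = map (skel 2) (args (eP (E i0)))).
{ intros i; apply (skel_type_eq (v_P (hv i0))); specialize (hk i).
  exact (f_equal snd hk). }
destruct (hA i0) as (WA & kA & cA & eA0 & _).
destruct (hP i0) as (WP & kP & cP & eP0 & _).
destruct (@generic_type C F0 I i0 (fun i => eΓ (E i)) [] γ0 var (fun i => eA (E i)) WA kA cA)
  as (k1 & Γ1 & γ1 & A1 & (hst1 & hex1 & hA1 & hu1) & hwA1); auto.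
{ now intros [|n]. }
{ intros i; destruct (hA i) as (W & k & c & h1 & h2 & _); congruence. }
{ intros i; apply v_A, hv. }
{ intros i; destruct (hA i) as (W & k & c & h1 & h2 & h); exact h. }
cbn [F0 empty_frame fm ftel Datatypes.app] in *.
setoid_rewrite up0 in hA1; setoid_rewrite up0 in hu1.
destruct (@all_generic C F0 I i0 (fun i => eΓ (E i)) (ea (E i0)) Γ1 γ1 var A1 (fun i => ea (E i)))
  as (k2 & Γ2 & γ2 & a2 & (hst2 & hex2 & ha2 & hu2) & hwa2); auto.
{ now intros [|n]. }
{ intros i; cbn; rewrite up0, hA1; apply v_a, hv. }
{ intros i; cbn; now rewrite !skel0. }
cbn [F0 empty_frame fm ftel Datatypes.app] in *.
rewrite up0 in hwa2; setoid_rewrite up0 in ha2; setoid_rewrite up0 in hu2.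
set (A2 := subst (shift k2) A1) in *.
assert (hA2 : wt Γ2 A2 None) by exact (wt_subst hwA1 (proj1 hex2)).
assert (eA2 : forall i, subst (γ2 i) A2 = eA (E i)).
{ intros i; unfold A2; rewrite subst_scomp, (extends_scomp i hex2); apply hA1. }
set (F2 := id_frame hA2 hwa2).
destruct (@generic_type C F2 I i0 (fun i => eΓ (E i)) Γ2 γ2 var (fun i => eP (E i)) WP kP cP)
  as (k3 & Γ3 & γ3 & P3 & (hst3 & hex3 & hP3 & hu3) & hwP3); auto.
{ exact (@wsub_var C Γ2). }
{ intros i; destruct (hP i) as (W & k & c & h1 & h2 & _); congruence. }
{ intros i; cbn [F2 id_frame ftel].
  change (scomp var (γ2 i)) with (γ2 i); rewrite eA2, ha2; apply v_P, hv. }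
{ intros i; destruct (hP i) as (W & k & c & h1 & h2 & h); exact h. }
cbn [F2 id_frame fm ftel] in *.
change (scomp var (shift k3)) with (shift (C := C) k3) in hwP3.
set (A3 := subst (shift k3) A2) in *; set (a3 := subst (shift k3) a2) in *.
assert (hA3 : wt Γ3 A3 None) by exact (wt_subst hA2 (proj1 hex3)).
assert (ha3 : wt Γ3 a3 (Some A3)) by exact (wt_subst hwa2 (proj1 hex3)).
assert (eA3 : forall i, subst (γ3 i) A3 = eA (E i)).
{ intros i; unfold A3; rewrite subst_scomp, (extends_scomp i hex3); apply eA2. }
assert (ea3 : forall i, subst (γ3 i) a3 = ea (E i)).
{ intros i; unfold a3; rewrite subst_scomp, (extends_scomp i hex3); apply ha2. }
pose proof (wt_subst hwP3 (idsec_wsub hA3 ha3)) as hD3; cbn [option_map] in hD3.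
destruct (@all_generic C F0 I i0 (fun i => eΓ (E i)) (ed (E i0)) Γ3 γ3 var
    (subst (idsec A3 a3) P3) (fun i => ed (E i)))
  as (k4 & Γ4 & γ4 & d4 & (hst4 & hex4 & hd4 & hu4) & hwd4); auto.
{ now intros [|n]. }
{ intros i; cbn; rewrite up0, <- (idsec_up _ _ _ hA3), eA3, ea3, hP3; apply v_d, hv. }
{ intros i; cbn; now rewrite !skel0. }
cbn [F0 empty_frame fm ftel Datatypes.app] in *.
rewrite up0 in hwd4; setoid_rewrite up0 in hd4; setoid_rewrite up0 in hu4.
exists (Elim Γ4 (subst (shift k4) A3) (subst (shift k4) a3) (subst (up 2 (shift k4)) P3) d4).
split; [|split].
- constructor; cbn [eΓ eA ea eP ed].
  + apply hst4.
  + exact (wt_subst hA3 (proj1 hex4)).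
  + exact (wt_subst ha3 (proj1 hex4)).
  + exact (wt_subst hwP3 (idtel_up hA3 (proj1 hex4))).
  + now rewrite (idsec_up _ _ _ hA3).
- intros e he hke; pose (i := exist (fun e => valid e /\ key e = κ) e (conj he hke) : I).
  exists (γ4 i); split; [apply (proj1 (proj2 hst4) i)|].
  unfold elim_subst; cbn [eΓ eA ea eP ed].
  rewrite subst_up_up, !subst_scomp, (extends_scomp i hex4).
  rewrite eA3, ea3, hP3, hd4; now destruct e.
- intros γ γ' Δ e; unfold elim_subst in e; cbn [eΓ eA ea eP ed] in *.
  injection e as e1 e2 e3 e4.
  rewrite !subst_up_up in e3; unfold A3, a3, A2 in *; repeat rewrite subst_scomp in e1; repeat rewrite subst_scomp in e2.
  (* Each form determines the variables added for it, given the older ones; going back from [d] to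
     [A] ends at the empty stage. *)
  apply (hu4 γ γ'); auto.
  apply (hu3 _ _) with (2 := e3).
  apply (hu2 _ _) with (2 := e2).
  apply (hu1 _ _) with (2 := e1).
  cbn; lia.
Qed.

Lemma elim_subst_valid e Δ s : valid e -> wf Δ -> wsub Δ s (eΓ e) ->
  valid (elim_subst s e Δ).
Proof.
intros [h1 h2 h3 h4 h5] hΔ hs; constructor; cbn; auto.
- exact (wt_subst h2 hs).
- exact (wt_subst h3 hs).
- exact (wt_subst h4 (idtel_up h2 hs)).
- rewrite (idsec_up _ _ _ h2); exact (wt_subst h5 hs).
Qed.

Lemma elim_subst_key e Δ s : valid e -> key (elim_subst s e Δ) = key e.
Proof.
intros [h1 h2 h3 h4 h5]; unfold key; cbn.
now rewrite <- (up0 s) at 1; rewrite (skel_type_up _ _ h2), (skel_type_up _ _ h4).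
Qed.

(* The data of key κ are instances of g in a unique way, so J of g, substituted,
   is a stable choice of J for all of them. *)
Record generic_J (κ : expr * expr) (g : elim) (j jβ : expr) : Prop := {
  gJ_valid : valid g;
  gJ_j : wt (idtel (eA g) (ea g) ++ eΓ g) j (Some (eP g));
  gJ_jβ : wt (eΓ g) jβ (Some (rId (subst (idsec (eA g) (ea g)) (eP g))
    (subst (idsec (eA g) (ea g)) j) (ed g)));
  gJ_cover : forall e, valid e -> key e = κ ->
    exists γ, wsub (eΓ e) γ (eΓ g) /\ elim_subst γ g (eΓ e) = e;
  gJ_unique : forall γ γ' Δ, elim_subst γ g Δ = elim_subst γ' g Δ ->
    forall n, n < length (eΓ g) -> γ n = γ' n
}.

Lemma generic_J_exists κ : exists t : elim * expr * expr,
  (exists e, valid e /\ key e = κ) -> generic_J κ (fst (fst t)) (snd (fst t)) (snd t).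
Proof.
destruct (classic (exists e, valid e /\ key e = κ)) as [h|h].
- destruct (generic_elim h) as (g & hg & hc & hu).
  destruct (J_exists (v_wf hg) (v_A hg) (v_a hg) (v_P hg) (v_d hg)) as (j & jβ & hj & hβ).
  exists (g, j, jβ); intros _; now constructor.
(* A dummy for keys of no valid datum, which keeps [generic_of] total. *)
- exists (Elim [] bot bot bot bot, bot, bot); intros h'; contradiction.
Qed.

Definition generic_of κ : elim * expr * expr :=
  proj1_sig (constructive_indefinite_description _ (generic_J_exists κ)).

Definition is_J (e : elim) (t : expr * expr) : Prop :=
  let g := generic_of (key e) in
  exists γ, wsub (eΓ e) γ (eΓ (fst (fst g))) /\
    elim_subst γ (fst (fst g)) (eΓ e) = e /\
    t = (subst (up 2 γ) (snd (fst g)), subst γ (snd g)).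

Lemma generic_of_spec e : valid e ->
  let g := generic_of (key e) in
  generic_J (key e) (fst (fst g)) (snd (fst g)) (snd g).
Proof. intros h; apply (proj2_sig (constructive_indefinite_description _ (generic_J_exists (key e)))); eauto. Qed.

Lemma is_J_exists e : exists t, valid e -> is_J e t.
Proof.
destruct (classic (valid e)) as [h|h]; [|now exists (bot, bot)].
destruct (gJ_cover (generic_of_spec h) h eq_refl) as (γ & h1 & h2).
eexists; intros _; exists γ; split; [exact h1|split; [exact h2|reflexivity] ].
Qed.

Definition rJ (e : elim) : expr * expr :=
  proj1_sig (constructive_indefinite_description _ (is_J_exists e)).

Lemma rJ_spec e : valid e -> is_J e (rJ e).
Proof. exact (proj2_sig (constructive_indefinite_description _ (is_J_exists e))). Qed.

(** [γ] is determined on the generic context, and [j] and [jβ] mention no other variables, apart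
    from the two bound ones of [j]. *)
Lemma is_J_unique e t t' : valid e -> is_J e t -> is_J e t' -> t = t'.
Proof.
intros h (γ & h1 & h2 & ->) (γ' & h1' & h2' & ->).
pose proof (generic_of_spec h) as hg; cbn zeta in hg.
assert (hn := gJ_unique hg (eq_trans h2 (eq_sym h2'))).
f_equal.
- apply (subst_scoped (wt_scoped (gJ_j hg))).
  intros n hl; change (length _) with (2 + length (eΓ (fst (fst (generic_of (key e)))))) in hl.
  destruct (lt_or_add 2 n) as [hm|[i ->] ]; [now rewrite !up_lt|].
  rewrite !up_add; f_equal; apply hn; lia.
- exact (subst_scoped (wt_scoped (gJ_jβ hg)) hn).
Qed.

Lemma rJ_wt e : valid e ->
  wt (idtel (eA e) (ea e) ++ eΓ e) (fst (rJ e)) (Some (eP e)) /\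
  wt (eΓ e) (snd (rJ e)) (Some (rId (subst (idsec (eA e) (ea e)) (eP e))
    (subst (idsec (eA e) (ea e)) (fst (rJ e))) (ed e))).
Proof.
intros h; destruct (rJ_spec h) as (γ & h1 & h2 & ->).
pose proof (generic_of_spec h) as hg; cbn zeta in hg.
revert hg h1 h2; generalize (generic_of (key e)).
intros [ [g j] jβ] hg h1 h2; cbn [fst snd] in *.
generalize (key e) hg; clear hg; intros κ hg.
rewrite <- h2; cbn [eΓ eA ea eP ed elim_subst].
pose proof (v_A (gJ_valid hg)) as hA.
split.
- exact (wt_subst (gJ_j hg) (idtel_up hA h1)).
- rewrite !(idsec_up _ _ _ hA).
  pose proof (wt_subst (gJ_jβ hg) h1) as h3; cbn [option_map] in h3.
  pose proof (wt_subst (v_P (gJ_valid hg)) (idsec_wsub hA (v_a (gJ_valid hg)))) as hB.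
  now rewrite (rId_subst _ _ _ hB) in h3.
Qed.

(** The key is unchanged by [s], so both sides come from the same generic datum; [γ] followed by [s]
    classifies the substituted datum, and uniqueness concludes. *)
Lemma rJ_subst e Δ s : valid e -> wf Δ -> wsub Δ s (eΓ e) ->
  rJ (elim_subst s e Δ) = (subst (up 2 s) (fst (rJ e)), subst s (snd (rJ e))).
Proof.
intros h hΔ hs.
apply (is_J_unique (elim_subst_valid h hΔ hs) (rJ_spec (elim_subst_valid h hΔ hs))).
destruct (rJ_spec h) as (γ & h1 & h2 & ->); unfold is_J.
rewrite (elim_subst_key _ _ h); exists (scomp γ s).
cbn [fst snd eΓ elim_subst]; split; [exact (wsub_comp h1 hs)|split].
- rewrite <- h2 at 2; unfold elim_subst; cbn [eΓ eA ea eP ed].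
  now rewrite subst_up_up, !subst_scomp.
- now rewrite subst_up_up, subst_scomp.
Qed.

End Id.

(** * The syntactic CwF *)

Section Syntactic.
Context (C : CwF).
Notation expr := (expr C).

Record ctx := Ctx {
  cΓ : list expr;
  cX : Ob C;
  cρ : list (sem cX);
  c_wfc : wfc cΓ cρ
}.

(** The map [hσ] is determined by the expressions ([hom_eq]). Storing it, as for types and terms,
    makes the interpretation a projection whose equations hold by reflexivity. *)
Record hom (Δ Γ : ctx) := MkHom {
  hs : list expr;
  hσ : Hom (cX Δ) (cX Γ);
  h_length : length hs = length (cΓ Γ);
  h_wsub : wsub (cΓ Δ) (of hs) (cΓ Γ);
  h_interp : Forall2 (interp (cρ Δ)) hs (map (ssub hσ) (cρ Γ))
}.

Record type (Γ : ctx) := MkType {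
  te : expr;
  tT : Ty (cX Γ);
  t_wt : wt (cΓ Γ) te None;
  t_interp : interp (cρ Γ) te (sty tT)
}.

Record term (Γ : ctx) (A : type Γ) := MkTerm {
  me : expr;
  ma : Tm (tT A);
  m_wt : wt (cΓ Γ) me (Some (te A));
  m_interp : interp (cρ Γ) me (stm ma)
}.

Lemma ctx_wf (Γ : ctx) : wf (cΓ Γ).
Proof. exists (cX Γ), (cρ Γ); apply c_wfc. Qed.

Lemma hom_eq Δ Γ (f g : hom Δ Γ) : hs f = hs g -> f = g.
Proof.
destruct f as [s σ h1 h2 h3], g as [s' σ' h1' h2' h3']; cbn; intros <-.
assert (σ = σ') as <-.
{ apply (wfc_mono (c_wfc Γ)).
  exact (interp_list_fun (wsub_args h1 h2) h3 h3'). }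
f_equal; apply proof_irrelevance.
Qed.

Lemma type_eq Γ (A B : type Γ) : te A = te B -> A = B.
Proof.
destruct A as [e T h1 h2], B as [e' T' h1' h2']; cbn; intros <-.
assert (T = T') as <- by (apply sty_inj; exact (interp_fun h1 h2 h2')).
f_equal; apply proof_irrelevance.
Qed.

Lemma term_eq Γ (A : type Γ) (a b : term A) : me a = me b -> a = b.
Proof.
destruct a as [e x h1 h2], b as [e' x' h1' h2']; cbn; intros <-.
assert (x = x') as <-.
{ pose proof (proj2 (stm_eq _ _) (interp_fun h1 h2 h2')) as e0.
  exact (inj_pair2 _ _ _ _ _ e0). }
f_equal; apply proof_irrelevance.
Qed.

(** Types are unique, so heterogeneous equations between terms reduce to equations of raw
    expressions. *)
Lemma term_oeq Γ (A B : type Γ) (a : term A) (b : term B) :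
  me a = me b -> oeq a b.
Proof.
intros e.
assert (A = B) as <-.
{ apply type_eq; pose proof (m_wt a) as h; rewrite e in h.
  pose proof (wt_unique h (m_wt b)); congruence. }
now rewrite (term_eq e).
Qed.

Lemma oeq_me Γ (A B : type Γ) (a : term A) (b : term B) : oeq a b -> me a = me b.
Proof.
exact (@f_equal _ _ (fun t : {A : type Γ & term A} => me (projT2 t)) _ _).
Qed.

Definition dproj (n : nat) : list expr := map var (seq 1 n).

Lemma of_dproj n j : j < n -> of (dproj n) j = shift 1 j.
Proof.
intros h; unfold dproj; rewrite of_map_var by now rewrite length_seq.
now rewrite seq_nth.
Qed.

Lemma subst_dproj Γ (e : expr) o : wt Γ e o ->
  subst (of (dproj (length Γ))) e = subst (shift 1) e.
Proof.
intros h; apply (subst_scoped (wt_scoped h)); intros; now apply of_dproj.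
Qed.

Lemma length_dproj n : length (dproj n) = n.
Proof. unfold dproj; now rewrite length_map, length_seq. Qed.

Lemma map_subst_dproj t ts n : length ts = n ->
  map (subst (of (t :: ts))) (dproj n) = ts.
Proof.
intros <-; unfold dproj; rewrite <- seq_shift, !map_map; cbn.
transitivity (map (subst (of ts)) (ids (length ts))); [|now apply map_of_ids].
unfold ids; now rewrite map_map.
Qed.

Lemma map_subst_ids Γ Δ (ts : list expr) : length ts = length Δ -> wsub Γ (of ts) Δ ->
  map (subst (of (ids (length Γ)))) ts = ts.
Proof.
intros el h; apply wsub_args in h; auto.
rewrite <- (map_id ts) at 2; apply map_ext_Forall.
revert h; apply Forall_impl; intros t [A hA]; exact (subst_ids (wt_scoped hA)).
Qed.

Definition hom_id (Γ : ctx) : hom Γ Γ.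
Proof.
refine (@MkHom Γ Γ (ids (length (cΓ Γ))) (idh _) _ _ _).
- apply length_ids.
- exact (wsub_ids (c_wfc Γ)).
- rewrite map_ssub_id, <- (wfc_length (c_wfc Γ)); apply ids_interp.
Defined.

Lemma interp_map_subst (X Y : Ob C) (ρ : list (sem X)) (ρ' : list (sem Y))
    (σ : Hom Y X) ts us l :
  Forall2 (interp ρ') us (map (ssub σ) ρ) -> Forall2 (interp ρ) ts l ->
  Forall2 (interp ρ') (map (subst (of us)) ts) (map (ssub σ) l).
Proof.
intros hu; induction 1; cbn [map]; constructor; auto.
eapply interp_subst_of; eauto.
Qed.

Definition hom_comp (Γ Δ Θ : ctx) (σ : hom Δ Γ) (τ : hom Θ Δ) : hom Θ Γ.
Proof.
refine (@MkHom Θ Γ (map (subst (of (hs τ))) (hs σ)) (hσ σ ∘ hσ τ) _ _ _).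
- rewrite length_map; apply h_length.
- intros n A hn; rewrite of_map, <- subst_of.
  exact (wt_subst (h_wsub σ hn) (h_wsub τ)).
- rewrite map_ssub_comp.
  exact (interp_map_subst (h_interp τ) (h_interp σ)).
Defined.

Definition ctx_emp : ctx := Ctx (wfc_nil C).

Definition hom_bang (Γ : ctx) : hom Γ ctx_emp.
Proof.
refine (@MkHom Γ ctx_emp [] (bang _) eq_refl _ _).
- now intros [|n].
- constructor.
Defined.

Definition type_sub (Δ Γ : ctx) (A : type Γ) (σ : hom Δ Γ) : type Δ.
Proof.
refine (@MkType Δ (subst (of (hs σ)) (te A)) (tT A)[[hσ σ]] _ _).
- exact (wt_subst (t_wt A) (h_wsub σ)).
- exact (interp_subst_of (t_interp A) (h_interp σ)).
Defined.

Definition term_sub (Δ Γ : ctx) (A : type Γ) (a : term A) (σ : hom Δ Γ) :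
  term (type_sub A σ).
Proof.
refine (@MkTerm Δ (type_sub A σ) (subst (of (hs σ)) (me a)) (ma a)[<hσ σ>] _ _).
- exact (wt_subst (m_wt a) (h_wsub σ)).
- exact (interp_subst_of (m_interp a) (h_interp σ)).
Defined.

Definition ctx_ext (Γ : ctx) (A : type Γ) : ctx :=
  Ctx (wfc_cons (c_wfc Γ) (t_wt A) (t_interp A)).

Definition hom_p (Γ : ctx) (A : type Γ) : hom (ctx_ext A) Γ.
Proof.
refine (@MkHom (ctx_ext A) Γ (dproj (length (cΓ Γ))) (p (tT A)) _ _ _).
- apply length_dproj.
- apply (wsub_scoped_ext (c_wfc Γ) (s := shift 1)).
  + intros n hn; symmetry; now apply of_dproj.
  + exact (@wsub_shift C [te A] (cΓ Γ)).
- pose proof (ids_interp (cρ (ctx_ext A))) as h; cbn [ctx_ext cρ] in h.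
  inversion h as [|? ? ? ? _ h2]; subst.
  rewrite length_map, (wfc_length (c_wfc Γ)) in h2.
  exact h2.
Defined.

Definition term_q (Γ : ctx) (A : type Γ) : term (type_sub A (hom_p A)).
Proof.
refine (@MkTerm (ctx_ext A) (type_sub A (hom_p A)) (var 0) (q (tT A)) _ _).
- cbn [type_sub te hom_p hs]; rewrite (subst_dproj (t_wt A)).
  now apply wt_var.
- reflexivity.
Defined.

Definition hom_pair (Δ Γ : ctx) (A : type Γ) (σ : hom Δ Γ)
    (a : term (type_sub A σ)) : hom Δ (ctx_ext A).
Proof.
refine (@MkHom Δ (ctx_ext A) (me a :: hs σ) (pair (hσ σ) (ma a)) _ _ _).
- cbn; f_equal; apply h_length.
- exact (wsub_cons (m_wt a) (h_wsub σ)).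
- cbn [ctx_ext cρ map]; constructor.
  + refine (eq_ind _ (interp (cρ Δ) (me a)) (m_interp a) _ _).
    apply (proj1 (stm_eq _ _)), oeq_sym, q_pair.
  + rewrite <- map_ssub_comp, p_pair; apply h_interp.
Defined.

Definition syn : CwF.
Proof.
refine (@Build_CwF ctx hom hom_id hom_comp _ _ _ ctx_emp hom_bang _
  type type_sub _ _ term term_sub _ _ ctx_ext hom_p term_q hom_pair _ _ _).
- intros; apply hom_eq; cbn.
  rewrite <- (h_length σ); now apply map_of_ids.
- intros; apply hom_eq; cbn.
  exact (map_subst_ids (h_length σ) (h_wsub σ)).
- intros; apply hom_eq; cbn.
  rewrite map_map; apply map_ext; intros; apply subst_of.
- intros; apply hom_eq; pose proof (h_length σ) as h; cbn in *.
  now destruct (hs σ).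
- intros; apply type_eq; exact (subst_ids (wt_scoped (t_wt A))).
- intros; apply type_eq; cbn; now rewrite subst_of.
- intros; apply term_oeq; exact (subst_ids (wt_scoped (m_wt a))).
- intros; apply term_oeq; cbn; now rewrite subst_of.
- intros; apply hom_eq; cbn; apply map_subst_dproj, h_length.
- intros; now apply term_oeq.
- intros Δ Γ A σ τ e1 e2; apply hom_eq.
  apply (f_equal (@hs _ _)) in e1; apply oeq_me in e2; cbn in e1, e2.
  pose proof (h_length σ) as l1; pose proof (h_length τ) as l2; cbn in l1, l2.
  destruct (hs σ) as [|t ts], (hs τ) as [|u us]; try easy.
  injection l1 as l1; injection l2 as l2.
  rewrite !map_subst_dproj in e1 by auto; cbn in e2; congruence.
Defined.

Definition interpretation : CwFMor syn C.
Proof.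
refine (@Build_CwFMor syn C cX hσ _ _ tT _ (fun Γ A a => ma a) _ eq_refl
  (fun _ _ => eq_refl) _ _); reflexivity.
Defined.

Lemma interpretation_trivial_fibration : TrivialFibration interpretation.
Proof.
constructor.
- intros Γ A.
  unshelve eexists (@MkType Γ (boxed_type (cΓ Γ) (cρ Γ) A) A _ _); [| |reflexivity].
  + apply wt_boxed_type, c_wfc.
  + apply interp_ids, c_wfc.
- intros Γ A a.
  unshelve eexists (@MkTerm Γ A (boxed_term (cΓ Γ) (cρ Γ) (te A) a) a _ _); [| |reflexivity].
  + apply wt_boxed_term; [apply c_wfc|apply t_wt|apply t_interp].
  + apply interp_ids, c_wfc.
Qed.

Lemma type_exists (Γ : ctx) e : wt (cΓ Γ) e None -> exists A : type Γ, te A = e.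
Proof.
intros h; destruct (sound_ty (c_wfc Γ) h) as [T hT].
now exists (MkType h hT).
Qed.

Lemma term_exists (Γ : ctx) (A : type Γ) e :
  wt (cΓ Γ) e (Some (te A)) -> exists a : term A, me a = e.
Proof.
intros h; destruct (sound_tm (c_wfc Γ) (t_interp A) h) as [a ha].
now exists (MkTerm h ha).
Qed.

(** The interpretation is obtained by choice, which is harmless since [type_eq] makes it unique. *)
Definition mk_type (Γ : ctx) e (h : wt (cΓ Γ) e None) : type Γ :=
  proj1_sig (constructive_indefinite_description _ (type_exists h)).

Definition mk_term (Γ : ctx) (A : type Γ) e (h : wt (cΓ Γ) e (Some (te A))) : term A :=
  proj1_sig (constructive_indefinite_description _ (term_exists h)).

Lemma te_mk_type (Γ : ctx) e (h : wt (cΓ Γ) e None) : te (mk_type h) = e.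
Proof. exact (proj2_sig (constructive_indefinite_description _ (type_exists h))). Qed.

Lemma me_mk_term (Γ : ctx) (A : type Γ) e (h : wt (cΓ Γ) e (Some (te A))) :
  me (mk_term h) = e.
Proof. exact (proj2_sig (constructive_indefinite_description _ (term_exists h))). Qed.

End Syntactic.

(** * The stable identity types *)

Section StableStructure.
Context (C : CwF) (IC : WeaklyStableId C).
Notation expr := (expr C).
Notation D := (syn C).
Implicit Types Γ Δ : Ob D.

(** The projections restated at the sorts of the CwF [D], so that rewriting meets CwF operations
    rather than record fields. *)
Definition raw {Γ} (A : Ty Γ) : expr := @te C Γ A.
Definition raw_tm {Γ} {A : Ty Γ} (a : Tm A) : expr := @me C Γ A a.
Definition raw_hom {Δ Γ} (σ : Hom Δ Γ) : list expr := @hs C Δ Γ σ.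
Definition tele Γ : list expr := @cΓ C Γ.

Lemma raw_wt Γ (A : Ty Γ) : wt (tele Γ) (raw A) None.
Proof. exact (t_wt A). Qed.

Lemma raw_tm_wt Γ (A : Ty Γ) (a : Tm A) : wt (tele Γ) (raw_tm a) (Some (raw A)).
Proof. exact (m_wt a). Qed.

Lemma raw_rew Γ (A B : Ty Γ) (e : A = B) (a : Tm A) :
  raw_tm (rew [Tm] e in a) = raw_tm a.
Proof. now destruct e. Qed.

Lemma raw_rew_r Γ (A B : Ty Γ) (e : A = B) (b : Tm B) :
  raw_tm (rew <- [Tm] e in b) = raw_tm b.
Proof. now destruct e. Qed.

Lemma raw_rew_hom Δ Θ (A B : Ty Δ) (e : A = B) (f : Hom (ext A) Θ) :
  raw_hom (rew [fun X => Hom (ext X) Θ] e in f) = raw_hom f.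
Proof. now destruct e. Qed.

Lemma raw_id_hom Γ : raw_hom (idh Γ) = ids (length (tele Γ)).
Proof. reflexivity. Qed.

Lemma raw_comp Γ Δ Θ (σ : Hom Δ Γ) (τ : Hom Θ Δ) :
  raw_hom (σ ∘ τ) = map (subst (of (raw_hom τ))) (raw_hom σ).
Proof. reflexivity. Qed.

Lemma raw_p Γ (A : Ty Γ) : raw_hom (p A) = dproj C (length (tele Γ)).
Proof. reflexivity. Qed.

Lemma raw_q Γ (A : Ty Γ) : raw_tm (q A) = var 0.
Proof. reflexivity. Qed.

Lemma raw_pair Δ Γ (A : Ty Γ) (σ : Hom Δ Γ) (a : Tm A[[σ]]) :
  raw_hom (pair σ a) = raw_tm a :: raw_hom σ.
Proof. reflexivity. Qed.

Definition syn_id Γ (A : Ty Γ) (x y : Tm A) : Ty Γ :=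
  mk_type (wt_rId IC (raw_wt A) (raw_tm_wt x) (raw_tm_wt y)).

Lemma raw_id Γ (A : Ty Γ) (x y : Tm A) :
  raw (syn_id x y) = rId IC (raw A) (raw_tm x) (raw_tm y).
Proof. apply te_mk_type. Qed.

Lemma syn_refl_wt Γ (A : Ty Γ) (x : Tm A) :
  wt (tele Γ) (rrefl IC (raw A) (raw_tm x)) (Some (raw (syn_id x x))).
Proof. rewrite raw_id; exact (wt_rrefl IC (raw_wt A) (raw_tm_wt x)). Qed.

Definition syn_refl Γ (A : Ty Γ) (x : Tm A) : Tm (syn_id x x) :=
  mk_term (syn_refl_wt x).

Lemma raw_refl Γ (A : Ty Γ) (x : Tm A) :
  raw_tm (syn_refl x) = rrefl IC (raw A) (raw_tm x).
Proof. apply me_mk_term. Qed.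

Definition syn_intro : StableIdIntro D.
Proof.
refine (@Build_StableIdIntro D syn_id _ syn_refl _).
- intros Δ Γ A x y σ; apply type_eq.
  transitivity (subst (of (raw_hom σ)) (raw (syn_id x y))); [reflexivity|].
  rewrite raw_id, (rId_subst _ _ _ _ (raw_wt A)); symmetry; apply raw_id.
- intros Δ Γ A x σ; apply term_oeq.
  transitivity (subst (of (raw_hom σ)) (raw_tm (syn_refl x))); [reflexivity|].
  rewrite raw_refl, (rrefl_subst _ _ _ (raw_wt A)); symmetry; apply raw_refl.
Defined.

Lemma raw_fam Γ (A : Ty Γ) (x : Tm A) :
  raw (sIdFam syn_intro x) = idfam IC (raw A) (raw_tm x).
Proof.
unfold sIdFam; transitivity (rId IC (subst (of (dproj C (length (tele Γ)))) (raw A))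
  (subst (of (dproj C (length (tele Γ)))) (raw_tm x)) (var 0)).
- exact (raw_id (x[<p A>]) (q A)).
- unfold idfam; now rewrite (subst_dproj (raw_wt A)), (subst_dproj (raw_tm_wt x)).
Qed.

Lemma tele_fam Γ (A : Ty Γ) (x : Tm A) :
  tele (ext (sIdFam syn_intro x)) = idtel IC (raw A) (raw_tm x) ++ tele Γ.
Proof.
change (raw (sIdFam syn_intro x) :: raw A :: tele Γ
  = idtel IC (raw A) (raw_tm x) ++ tele Γ).
now rewrite raw_fam.
Qed.

Lemma raw_srefl_inst Γ (A : Ty Γ) (x : Tm A) :
  raw_hom (srefl_inst syn_intro x)
  = rrefl IC (raw A) (raw_tm x) :: raw_tm x :: ids (length (tele Γ)).
Proof.
unfold srefl_inst, inst.
now rewrite !raw_pair, !raw_rew_r, raw_id_hom, <- raw_refl.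
Qed.

Lemma subst_srefl_inst Γ (A : Ty Γ) (x : Tm A) e o :
  wt (tele (ext (sIdFam syn_intro x))) e o ->
  subst (of (raw_hom (srefl_inst syn_intro x))) e
  = subst (idsec IC (raw A) (raw_tm x)) e.
Proof.
intros h; rewrite tele_fam in h; apply (subst_scoped (wt_scoped h)).
intros n hn; rewrite raw_srefl_inst; now apply idsec_of.
Qed.

Lemma raw_lift Δ Γ (σ : Hom Δ Γ) (A : Ty Γ) :
  raw_hom (lift σ A)
  = var 0 :: map (subst (of (dproj C (length (tele Δ))))) (raw_hom σ).
Proof.
unfold lift; now rewrite raw_pair, raw_rew_r, raw_comp, raw_p, raw_q.
Qed.

Lemma of_raw_lift Δ Γ (σ : Hom Δ Γ) (A : Ty Γ) n : n < S (length (tele Γ)) ->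
  of (raw_hom (lift σ A)) n = up 1 (of (raw_hom σ)) n.
Proof.
intros hn; rewrite raw_lift; destruct n as [|n]; auto.
change (S n) with (1 + n) at 2; rewrite up_add.
transitivity (of (map (subst (of (dproj C (length (tele Δ))))) (raw_hom σ)) n); auto.
rewrite of_map.
destruct (nth_error (tele Γ) n) as [B|] eqn:e.
- exact (subst_dproj (h_wsub σ e)).
- apply nth_error_None in e; lia.
Qed.

Lemma of_raw_lift2 Δ Γ (σ : Hom Δ Γ) (A : Ty Γ) (x : Tm A) n :
  n < 2 + length (tele Γ) ->
  of (raw_hom (sIdFam_lift2 syn_intro σ x)) n = up 2 (of (raw_hom σ)) n.
Proof.
intros hn; unfold sIdFam_lift2.
rewrite raw_rew_hom.
rewrite of_raw_lift by exact hn; rewrite (up_succ 1).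
destruct n as [|n]; auto.
change (S n) with (1 + n); rewrite !up_add; f_equal.
apply of_raw_lift; cbn in hn; lia.
Qed.

Lemma subst_lift2 Δ Γ (σ : Hom Δ Γ) (A : Ty Γ) (x : Tm A) e o :
  wt (idtel IC (raw A) (raw_tm x) ++ tele Γ) e o ->
  subst (of (raw_hom (sIdFam_lift2 syn_intro σ x))) e
  = subst (up 2 (of (raw_hom σ))) e.
Proof.
intros h; apply (subst_scoped (wt_scoped h)); intros n hn; now apply of_raw_lift2.
Qed.

Definition raw_elim Γ (A : Ty Γ) (x : Tm A) (P : Ty (ext (sIdFam syn_intro x)))
    (d : Tm P[[srefl_inst syn_intro x]]) : elim C :=
  Elim (tele Γ) (raw A) (raw_tm x) (raw P) (raw_tm d).

Lemma raw_elim_valid Γ (A : Ty Γ) (x : Tm A) (P : Ty (ext (sIdFam syn_intro x)))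
    (d : Tm P[[srefl_inst syn_intro x]]) : valid IC (raw_elim d).
Proof.
constructor; cbn [raw_elim eΓ eA ea eP ed].
- apply ctx_wf.
- apply raw_wt.
- apply raw_tm_wt.
- rewrite <- tele_fam; apply raw_wt.
- rewrite <- (subst_srefl_inst (raw_wt P)); apply (raw_tm_wt d).
Qed.

Lemma raw_elim_sub Δ Γ (A : Ty Γ) (x : Tm A) (P : Ty (ext (sIdFam syn_intro x)))
    (d : Tm P[[srefl_inst syn_intro x]]) (σ : Hom Δ Γ) :
  raw_elim (sub_prem d σ) = elim_subst (of (raw_hom σ)) (raw_elim d) (tele Δ).
Proof.
unfold raw_elim, elim_subst, sub_prem; cbn [eΓ eA ea eP ed]; f_equal.
- apply (@subst_lift2 Δ Γ σ A x _ None).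
  rewrite <- tele_fam; apply raw_wt.
- apply raw_rew.
Qed.

Lemma syn_J_wt Γ (A : Ty Γ) (x : Tm A) (P : Ty (ext (sIdFam syn_intro x)))
    (d : Tm P[[srefl_inst syn_intro x]]) :
  wt (tele (ext (sIdFam syn_intro x))) (fst (rJ IC (raw_elim d))) (Some (raw P)).
Proof. rewrite tele_fam; exact (proj1 (rJ_wt (raw_elim_valid d))). Qed.

Definition syn_J Γ (A : Ty Γ) (x : Tm A) (P : Ty (ext (sIdFam syn_intro x)))
    (d : Tm P[[srefl_inst syn_intro x]]) : Tm P := mk_term (syn_J_wt d).

Lemma raw_J Γ (A : Ty Γ) (x : Tm A) (P : Ty (ext (sIdFam syn_intro x)))
    (d : Tm P[[srefl_inst syn_intro x]]) :
  raw_tm (syn_J d) = fst (rJ IC (raw_elim d)).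
Proof. apply me_mk_term. Qed.

Lemma syn_Jβ_wt Γ (A : Ty Γ) (x : Tm A) (P : Ty (ext (sIdFam syn_intro x)))
    (d : Tm P[[srefl_inst syn_intro x]]) :
  wt (tele Γ) (snd (rJ IC (raw_elim d)))
    (Some (raw (sId syn_intro (syn_J d)[<srefl_inst syn_intro x>] d))).
Proof.
replace (raw (sId syn_intro (syn_J d)[<srefl_inst syn_intro x>] d))
  with (rId IC (subst (idsec IC (raw A) (raw_tm x)) (raw P))
    (subst (idsec IC (raw A) (raw_tm x)) (fst (rJ IC (raw_elim d)))) (raw_tm d)).
- exact (proj2 (rJ_wt (raw_elim_valid d))).
- rewrite <- raw_J, <- (subst_srefl_inst (raw_wt P)),
    <- (subst_srefl_inst (raw_tm_wt (syn_J d))).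
  symmetry; apply raw_id.
Qed.

Definition syn_Jβ Γ (A : Ty Γ) (x : Tm A) (P : Ty (ext (sIdFam syn_intro x)))
    (d : Tm P[[srefl_inst syn_intro x]]) :
    Tm (sId syn_intro (syn_J d)[<srefl_inst syn_intro x>] d) :=
  mk_term (syn_Jβ_wt d).

Definition syn_stable : StableId D.
Proof.
assert (hs : forall Δ Γ (A : Ty Γ) (x : Tm A) (P : Ty (ext (sIdFam syn_intro x)))
    (d : Tm P[[srefl_inst syn_intro x]]) (σ : Hom Δ Γ),
  rJ IC (raw_elim (sub_prem d σ)) =
    (subst (up 2 (of (raw_hom σ))) (fst (rJ IC (raw_elim d))),
     subst (of (raw_hom σ)) (snd (rJ IC (raw_elim d))))).
{ intros; rewrite raw_elim_sub; apply rJ_subst;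
    [apply raw_elim_valid|apply ctx_wf|exact (h_wsub σ)]. }
refine (@Build_StableId D syn_intro syn_J _ syn_Jβ _).
- intros Δ Γ A x P d σ; apply term_eq.
  transitivity (subst (of (raw_hom (sIdFam_lift2 syn_intro σ x))) (raw_tm (syn_J d)));
    [reflexivity|].
  transitivity (raw_tm (syn_J (sub_prem d σ))); [|reflexivity].
  rewrite !raw_J, hs; eapply subst_lift2; rewrite <- tele_fam; apply syn_J_wt.
- intros Δ Γ A x P d σ; apply term_oeq.
  transitivity (subst (of (raw_hom σ)) (raw_tm (syn_Jβ d))); [reflexivity|].
  transitivity (raw_tm (syn_Jβ (sub_prem d σ))); [|reflexivity].
  unfold syn_Jβ, raw_tm; rewrite !me_mk_term; now rewrite hs.
Defined.

(** Both types are identity families pointed over the interpretation of [x], one by the reflexivity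
    of [D] and one by [wrefl]. *)
Lemma interpretation_preserves_id :
  WeaklyPreservesId syn_stable IC (interpretation C).
Proof.
intros Γ A x.
(* [fob_ext] computes to [eq_refl], so the transport vanishes. *)
change (ty_equivalent IC (fty (interpretation C) (sIdFam syn_intro x))
  (wId IC (ftm (interpretation C) x))).
pose proof (t_interp (sIdFam syn_intro x)) as hU.
change (te (sIdFam syn_intro x)) with (raw (sIdFam syn_intro x)) in hU.
rewrite raw_fam in hU.
pose proof (interp_idfam_inst (c_wfc Γ) (raw_wt A) (raw_tm_wt x) (m_interp x) hU) as hV.
destruct (sound_tm (c_wfc Γ) hV (wt_rrefl IC (raw_wt A) (raw_tm_wt x))) as [r hr].
eapply id_families_equivalent.
- exact (rrefl_is_id_family (c_wfc Γ) (raw_wt A) (raw_tm_wt x) (t_interp A)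
    (m_interp x) hU hr eq_refl).
(* The identity type of [C] is its own instance along the identity. *)
- apply (@instance_is_id_family C IC _ _ _ (ma x) (idh _) _ (ma x) (idh _) _ (wrefl IC (ma x))).
  + apply oeq_sym, sub_id.
  + now rewrite comp_id_l, comp_id_r.
  + apply sub_id.
  + symmetry; apply tsub_id.
  + apply oeq_sym, sub_id.
Qed.

End StableStructure.

Theorem theorem3 (C : CwF) (IC : WeaklyStableId C) :
  exists (D : CwF) (ID : StableId D) (F : CwFMor D C),
    inhabited (TrivialFibration F) /\ WeaklyPreservesId ID IC F.
Proof.
exists (syn C), (syn_stable IC), (interpretation C); split.
- constructor; apply interpretation_trivial_fibration.
- apply interpretation_preserves_id.
Qed.
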